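(* Let $(\mathfrak g,\lhd,\mathfrak a)$ be a right Lie module over a field of characteristic zero, and put $H=\mathcal U(\mathfrak g)$, $K=\mathcal U(\mathfrak a)$. Let $G_\#$ be the group of coalgebra morphisms from $H$ to $K$ with product $\#$. Then the map $$A\longmapsto e_A^{-1}\qquad(A\in G_\#),$$ where $e_A^{-1}$ is the compositional inverse of the transform $e_A\colon H\to H$, is a group morphism from $G_\#$ to the group of (invertible) coalgebra endomorphisms of $H$ equipped with composition; that is, $e_{A\#B}^{-1}=e_A^{-1}\circ e_B^{-1}$ for all $A,B\in G_\#$.
   Context: A right Lie module $(\mathfrak g,\lhd,\mathfrak a)$: Lie algebras $\mathfrak g,\mathfrak a$ and a bilinear map $\lhd\colon\mathfrak g\times\mathfrak a\to\mathfrak g$ with $[x,y]\lhd a=[x\lhd a,y]+[x,y\lhd a]$ and $x\lhd[a,b]=(x\lhd a)\lhd b-(x\lhd b)\lhd a$. The action extends uniquely to a right action $\lhd$ of the algebra $\mathcal U(\mathfrak a)$ on $\mathcal U(\mathfrak g)$ such that each $a\in\mathfrak a$ acts by the derivation extending $x\mapsto x\lhd a$; then $(XY)\lhd A=(X\lhd A_{(1)})(Y\lhd A_{(2)})$ and $\lhd$ is a coalgebra map. Enveloping algebras carry their standard cocommutative Hopf structure; $\varepsilon,\mathcal S$ are counit and antipode; Sweedler notation is used. For linear maps $A,B\colon H\to K$, $(A\#B)(f)=A\big(f_{(1)}\lhd\mathcal S_K(B(f_{(2)})_{(1)})\big)\,B(f_{(2)})_{(2)}$; the coalgebra morphisms form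 a group for $\#$. For a coalgebra morphism $T\colon H\to K$, the transform $e_T\colon H\to H$ is the unique linear map with $\varepsilon_H\circ e_T=\varepsilon_H$ and $e_T(f)=f_{(1)}\lhd T(e_T(f_{(2)}))$ for all $f\in H$; it is an automorphism of the coalgebra $H$. *)

(* Defs.v *)
From HB Require Import structures.
From mathcomp Require Import all_boot all_order all_algebra.
From mathcomp Require Import generic_quotient boolp.

Set Implicit Arguments.
Unset Strict Implicit.
Unset Printing Implicit Defensive.
Import GRing.Theory.
Local Open Scope ring_scope.
Local Open Scope quotient_scope.

HB.mixin Record Lmodule_isLieAlgebra (k : fieldType) L of GRing.Lmodule k L := {
  lie : L -> L -> L;
  lie_linearl : forall y, linear (fun x => lie x y);
  lie_linearr : forall x, linear (lie x);
  liexx : forall x, lie x x = 0;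
  lie_jacobi : forall x y z,
    lie x (lie y z) + lie y (lie z x) + lie z (lie x y) = 0
}.

#[short(type="lieAlgType")]
HB.structure Definition LieAlgebra (k : fieldType) :=
  { L of GRing.Lmodule k L & Lmodule_isLieAlgebra k L }.

Record rightLieModule (k : fieldType) (g a : lieAlgType k) := RightLieModule {
  lact : g -> a -> g;
  lact_linearl : forall b, linear (fun x => lact x b);
  lact_linearr : forall x, linear (lact x);
  lact_lie : forall x y b,
    lact (lie x y) b = lie (lact x b) y + lie x (lact y b);
  lact_lier : forall x b c,
    lact x (lie b c) = lact (lact x b) c - lact (lact x c) b
}.

(* [tens V W] is presented by the generators [TPure v w] (to be read v (x) w)
   and the module operations, modulo the congruence [teq] generated by the
   module axioms and bilinearity of [TPure]. *)
Section Tensor.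
Context (k : fieldType) (V W : lmodType k).

Inductive tterm :=
  | TPure of V & W
  | TAdd of tterm & tterm
  | TScale of k & tterm.

Inductive teq : tterm -> tterm -> Prop :=
  | teq_refl t : teq t t
  | teq_sym s t : teq s t -> teq t s
  | teq_trans s t r : teq s t -> teq t r -> teq s r
  | teq_add s s' t t' : teq s s' -> teq t t' -> teq (TAdd s t) (TAdd s' t')
  | teq_scale c s s' : teq s s' -> teq (TScale c s) (TScale c s')
  | teq_addA s t r : teq (TAdd s (TAdd t r)) (TAdd (TAdd s t) r)
  | teq_addC s t : teq (TAdd s t) (TAdd t s)
  | teq_add0 t : teq (TAdd (TPure 0 0) t) t
  | teq_addN t : teq (TAdd (TScale (-1) t) t) (TPure 0 0)
  | teq_scaleA c d t : teq (TScale c (TScale d t)) (TScale (c * d) t)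
  | teq_scale1 t : teq (TScale 1 t) t
  | teq_scaleDr c s t : teq (TScale c (TAdd s t)) (TAdd (TScale c s) (TScale c t))
  | teq_scaleDl c d t : teq (TScale (c + d) t) (TAdd (TScale c t) (TScale d t))
  | teq_pureDl v v' w : teq (TPure (v + v') w) (TAdd (TPure v w) (TPure v' w))
  | teq_pureDr v w w' : teq (TPure v (w + w')) (TAdd (TPure v w) (TPure v w'))
  | teq_pureZl c v w : teq (TPure (c *: v) w) (TScale c (TPure v w))
  | teq_pureZr c v w : teq (TPure v (c *: w)) (TScale c (TPure v w)).

HB.instance Definition _ := gen_eqMixin tterm.
HB.instance Definition _ := gen_choiceMixin tterm.

Definition teqb : rel tterm := fun s t => `[< teq s t >].

Lemma teqb_equiv : equiv_class_of teqb.
Proof.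
split.
- by move=> t; apply/asboolP; exact: teq_refl.
- by move=> s t; apply/asboolP/asboolP; exact: teq_sym.
- by move=> t s r /asboolP st /asboolP tr; apply/asboolP; exact: teq_trans st tr.
Qed.

Canonical teqb_equivRel := EquivRelPack teqb_equiv.

Definition tens := {eq_quot teqb_equivRel}.
HB.instance Definition _ := Choice.on tens.
HB.instance Definition _ := EqQuotient.on tens.

Definition pure (v : V) (w : W) : tens := \pi_tens (TPure v w).

Lemma tpiP s t : reflect (teq s t) (\pi_tens s == \pi_tens t).
Proof. by rewrite piE; exact: asboolP. Qed.

Lemma tpi s t : teq s t -> \pi_tens s = \pi_tens t.
Proof. by move=> st; apply/eqP/tpiP. Qed.

Lemma treprP t : teq (repr (\pi_tens t)) t.
Proof. by apply/tpiP; rewrite reprK. Qed.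

Definition tens_zero : tens := \pi_tens (TPure 0 0).
Definition tens_add (s t : tens) : tens :=
  locked (\pi_tens (TAdd (repr s) (repr t))).
Definition tens_scale c (s : tens) : tens :=
  locked (\pi_tens (TScale c (repr s))).
Definition tens_opp := tens_scale (-1).

Lemma pi_tadd s t : tens_add (\pi_tens s) (\pi_tens t) = \pi_tens (TAdd s t).
Proof. by rewrite /tens_add -lock; apply/tpi/teq_add; exact: treprP. Qed.
Lemma pi_tscale c s : tens_scale c (\pi_tens s) = \pi_tens (TScale c s).
Proof. by rewrite /tens_scale -lock; apply/tpi/teq_scale; exact: treprP. Qed.

Fact tens_addA : associative tens_add.
Proof.
elim/quotW=> s; elim/quotW=> t; elim/quotW=> r.
by rewrite !pi_tadd; apply: tpi; exact: teq_addA.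
Qed.
Fact tens_addC : commutative tens_add.
Proof. by elim/quotW=> s; elim/quotW=> t; rewrite !pi_tadd; apply: tpi; exact: teq_addC. Qed.
Fact tens_add0 : left_id tens_zero tens_add.
Proof. by elim/quotW=> t; rewrite /tens_zero !pi_tadd; apply: tpi; exact: teq_add0. Qed.
Fact tens_addN : left_inverse tens_zero tens_opp tens_add.
Proof.
elim/quotW=> t.
by rewrite /tens_opp /tens_zero pi_tscale pi_tadd; apply: tpi; exact: teq_addN.
Qed.
HB.instance Definition _ :=
  GRing.isZmodule.Build tens tens_addA tens_addC tens_add0 tens_addN.

Fact tens_scaleA c d t : tens_scale c (tens_scale d t) = tens_scale (c * d) t.
Proof. by elim/quotW: t => t; rewrite !pi_tscale; apply: tpi; exact: teq_scaleA. Qed.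
Fact tens_scale1 : left_id 1 tens_scale.
Proof. by elim/quotW=> t; rewrite !pi_tscale; apply: tpi; exact: teq_scale1. Qed.
Fact tens_scaleDr : right_distributive tens_scale +%R.
Proof.
move=> c; elim/quotW=> s; elim/quotW=> t.
by rewrite /GRing.add /= pi_tadd !pi_tscale pi_tadd; apply: tpi; exact: teq_scaleDr.
Qed.
Fact tens_scaleDl t : {morph tens_scale^~ t : c d / c + d}.
Proof.
move=> c d; elim/quotW: t => t.
by rewrite !pi_tscale [RHS]pi_tadd; apply: tpi; exact: teq_scaleDl.
Qed.
HB.instance Definition _ := GRing.Zmodule_isLmodule.Build k tens
  tens_scaleA tens_scale1 tens_scaleDr tens_scaleDl.

Lemma pureDl v v' w : pure (v + v') w = pure v w + pure v' w.
Proof. by rewrite [RHS]pi_tadd; apply: tpi; exact: teq_pureDl. Qed.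
Lemma pureDr v w w' : pure v (w + w') = pure v w + pure v w'.
Proof. by rewrite [RHS]pi_tadd; apply: tpi; exact: teq_pureDr. Qed.
Lemma pureZl c v w : pure (c *: v) w = c *: pure v w.
Proof. by rewrite [RHS]pi_tscale; apply: tpi; exact: teq_pureZl. Qed.
Lemma pureZr c v w : pure v (c *: w) = c *: pure v w.
Proof. by rewrite [RHS]pi_tscale; apply: tpi; exact: teq_pureZr. Qed.

Lemma tens_ind (P : tens -> Prop) :
  (forall v w, P (pure v w)) -> (forall s t, P s -> P t -> P (s + t)) ->
  forall t, P t.
Proof.
move=> Pp Pa; elim/quotW=> t; suff: forall c, P (c *: \pi_tens t).
  by move/(_ 1); rewrite scale1r.
elim: t => [v w|s IHs t IHt|d t IHt] c.
- by rewrite -/(pure v w) -pureZl.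
- have -> : \pi_tens (TAdd s t) = \pi_tens s + \pi_tens t by rewrite -pi_tadd.
  by rewrite scalerDr; apply: Pa.
- have -> : \pi_tens (TScale d t) = d *: \pi_tens t by rewrite -pi_tscale.
  by rewrite scalerA.
Qed.

End Tensor.

Section TensorLift.
Context (k : fieldType) (V W : lmodType k) (Z : lmodType k).

Definition bilin (F : V -> W -> Z) :=
  (forall w, linear (fun v => F v w)) /\ (forall v, linear (F v)).

Fixpoint teval (F : V -> W -> Z) (t : tterm V W) : Z :=
  match t with
  | TPure v w => F v w
  | TAdd s t => teval F s + teval F t
  | TScale c t => c *: teval F t
  end.

(* The linear map v (x) w |-> F v w. It is defined by evaluating a chosen
   representative, hence is meaningful when [F] is bilinear (see [tliftE]).
   In Sweedler notation, [tlift (fun u v => F u v) (comult f)] is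
   F(f_(1), f_(2)). *)
Definition tlift (F : V -> W -> Z) (t : tens V W) : Z := teval F (repr t).

Lemma teval_teq F : bilin F -> forall s t, teq s t -> teval F s = teval F t.
Proof.
move=> [Fl Fr].
have FDl v v' w : F (v + v') w = F v w + F v' w.
  by have := Fl w 1 v v'; rewrite !scale1r.
have FDr v w w' : F v (w + w') = F v w + F v w'.
  by have := Fr v 1 w w'; rewrite !scale1r.
have F0l w : F 0 w = 0 by apply: (@addIr _ (F 0 w)); rewrite -FDl addr0 add0r.
have F0r v : F v 0 = 0 by apply: (@addIr _ (F v 0)); rewrite -FDr addr0 add0r.
have FZl c v w : F (c *: v) w = c *: F v w.
  by have := Fl w c v 0; rewrite F0l !addr0.
have FZr c v w : F v (c *: w) = c *: F v w.
  by have := Fr v c w 0; rewrite F0r !addr0.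
move=> s t; elim=> {s t} //=.
- by move=> s t r _ -> _ ->.
- by move=> s s' t t' _ -> _ ->.
- by move=> c s s' _ ->.
- by move=> *; rewrite addrA.
- by move=> *; rewrite addrC.
- by move=> *; rewrite F0l add0r.
- by move=> *; rewrite scaleN1r addNr F0l.
- by move=> *; rewrite scalerA.
- by move=> *; rewrite scale1r.
- by move=> *; rewrite scalerDr.
- by move=> *; rewrite scalerDl.
Qed.

Lemma tlift_pi F : bilin F -> forall t, tlift F (\pi_(tens V W) t) = teval F t.
Proof. by move=> bF t; apply: (teval_teq bF); exact: treprP. Qed.

Lemma tliftE F : bilin F -> forall v w, tlift F (pure v w) = F v w.
Proof. by move=> bF v w; rewrite tlift_pi. Qed.

Lemma tlift_linear F : bilin F -> linear (tlift F).
Proof.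
move=> bF c; elim/quotW=> s; elim/quotW=> t.
have -> : c *: \pi_(tens V W) s + \pi_(tens V W) t
  = \pi_(tens V W) (TAdd (TScale c s) t).
  by rewrite -pi_tadd -pi_tscale.
by rewrite !tlift_pi.
Qed.

End TensorLift.

Section TensorRing.
Context (k : fieldType) (A B : algType k).

Definition tens_one : tens A B := pure 1 1.
Definition tens_mul (s t : tens A B) : tens A B :=
  tlift (fun u v => tlift (fun u' v' => pure (u * u') (v * v')) t) s.

Let bil_in u v : bilin (fun u' v' => pure (u * u') (v * v') : tens A B).
Proof.
split=> [w|w] c x y; rewrite mulrDr -scalerAr ?pureDl ?pureZl //.
by rewrite pureDr pureZr.
Qed.

Let bil_out t :
  bilin (fun u v => tlift (fun u' v' => pure (u * u') (v * v')) t : tens A B).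
Proof.
have L u v := tlift_linear (bil_in u v).
have LD u v s s' : tlift (fun u' v' => pure (u * u') (v * v')) (s + s') =
   tlift (fun u' v' => pure (u * u') (v * v')) s +
   tlift (fun u' v' => pure (u * u') (v * v')) s' :> tens A B.
  by have := L u v 1 s s'; rewrite !scale1r.
split=> [w|w] c x y; elim/tens_ind: t => [u v|s t IHs IHt].
- by rewrite !(tliftE (bil_in _ _)) mulrDl -scalerAl pureDl pureZl.
- by rewrite !LD IHs IHt scalerDr addrACA.
- by rewrite !(tliftE (bil_in _ _)) mulrDl -scalerAl pureDr pureZr.
- by rewrite !LD IHs IHt scalerDr addrACA.
Qed.

Lemma tens_mulE u v u' v' :
  tens_mul (pure u v) (pure u' v') = pure (u * u') (v * v').
Proof. by rewrite /tens_mul (tliftE (bil_out _)) (tliftE (bil_in _ _)). Qed.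

Fact tens_mulDl : left_distributive tens_mul +%R.
Proof.
move=> s s' t; have := tlift_linear (bil_out t) 1 s s'.
by rewrite !scale1r.
Qed.

Fact tens_mulZl c s t : tens_mul (c *: s) t = c *: tens_mul s t.
Proof.
have := tlift_linear (bil_out t) c s 0; rewrite addr0 => h.
rewrite -[LHS]/(tlift _ _) h -[X in _ + X]/(tens_mul 0 t).
suff -> : tens_mul 0 t = 0 by rewrite addr0.
by apply: (@addIr _ (tens_mul 0 t)); rewrite -tens_mulDl addr0 add0r.
Qed.

Fact tens_mul_linr s : linear (tens_mul s).
Proof.
elim/tens_ind: s => [u v|s s' IHs IHs'] c x y.
  by rewrite /tens_mul !(tliftE (bil_out _)) (tlift_linear (bil_in u v)).
by rewrite !tens_mulDl IHs IHs' scalerDr addrACA.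
Qed.

Fact tens_mulDr : right_distributive tens_mul +%R.
Proof. by move=> s t t'; have := tens_mul_linr s 1 t t'; rewrite !scale1r. Qed.

Fact tens_mulA : associative tens_mul.
Proof.
elim/tens_ind => [u v|s s' IHs IHs'] t r; last by rewrite !tens_mulDl IHs IHs'.
elim/tens_ind: t => [u' v'|t t' IHt IHt']; last first.
  by rewrite tens_mulDl !tens_mulDr tens_mulDl IHt IHt'.
elim/tens_ind: r => [x y|r r' IHr IHr']; last by rewrite !tens_mulDr IHr IHr'.
by rewrite !tens_mulE !mulrA.
Qed.

Fact tens_mul1 : left_id tens_one tens_mul.
Proof.
elim/tens_ind => [u v|s t IHs IHt]; last by rewrite tens_mulDr IHs IHt.
by rewrite tens_mulE !mul1r.
Qed.

Fact tens_mulr1 : right_id tens_one tens_mul.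
Proof.
elim/tens_ind => [u v|s t IHs IHt]; last by rewrite tens_mulDl IHs IHt.
by rewrite tens_mulE !mulr1.
Qed.

HB.instance Definition _ := GRing.Zmodule_isPzRing.Build (tens A B)
  tens_mulA tens_mul1 tens_mulr1 tens_mulDl tens_mulDr.

Lemma mul_pure (u u' : A) (v v' : B) :
  pure u v * pure u' v' = pure (u * u') (v * v').
Proof. exact: tens_mulE. Qed.

Lemma tens_scaleAl c (s t : tens A B) : c *: (s * t) = (c *: s) * t.
Proof. by rewrite [RHS]tens_mulZl. Qed.

Lemma tens_scaleAr c (s t : tens A B) : c *: (s * t) = s * (c *: t).
Proof.
have := tens_mul_linr s c t 0; rewrite addr0 => h.
have h0 : tens_mul s 0 = 0 := mulr0 s.
by rewrite -[RHS]/(tens_mul _ _) h h0 addr0.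
Qed.

End TensorRing.

(* [uea g] is presented by the generators [UGen x], x in g, and the algebra
   operations ([UConst c] is the scalar c), modulo the congruence generated by
   the axioms of associative unital k-algebras, k-linearity of [UGen] and
   [x, y] = x y - y x. *)
Section Enveloping.
Context (k : fieldType) (g : lieAlgType k).

Inductive uterm :=
  | UGen of g
  | UConst of k
  | UAdd of uterm & uterm
  | UMul of uterm & uterm.

Inductive ueq : uterm -> uterm -> Prop :=
  | ueq_refl t : ueq t t
  | ueq_sym s t : ueq s t -> ueq t s
  | ueq_trans s t r : ueq s t -> ueq t r -> ueq s r
  | ueq_add s s' t t' : ueq s s' -> ueq t t' -> ueq (UAdd s t) (UAdd s' t')
  | ueq_mul s s' t t' : ueq s s' -> ueq t t' -> ueq (UMul s t) (UMul s' t')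
  | ueq_addA s t r : ueq (UAdd s (UAdd t r)) (UAdd (UAdd s t) r)
  | ueq_addC s t : ueq (UAdd s t) (UAdd t s)
  | ueq_add0 t : ueq (UAdd (UConst 0) t) t
  | ueq_addN t : ueq (UAdd (UMul (UConst (-1)) t) t) (UConst 0)
  | ueq_mulA s t r : ueq (UMul s (UMul t r)) (UMul (UMul s t) r)
  | ueq_mul1 t : ueq (UMul (UConst 1) t) t
  | ueq_mulDl s t r : ueq (UMul (UAdd s t) r) (UAdd (UMul s r) (UMul t r))
  | ueq_mulDr s t r : ueq (UMul s (UAdd t r)) (UAdd (UMul s t) (UMul s r))
  | ueq_constD c d : ueq (UConst (c + d)) (UAdd (UConst c) (UConst d))
  | ueq_constM c d : ueq (UConst (c * d)) (UMul (UConst c) (UConst d))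
  | ueq_constC c t : ueq (UMul (UConst c) t) (UMul t (UConst c))
  | ueq_genD x y : ueq (UGen (x + y)) (UAdd (UGen x) (UGen y))
  | ueq_genZ c x : ueq (UGen (c *: x)) (UMul (UConst c) (UGen x))
  | ueq_lie x y : ueq (UGen (lie x y))
      (UAdd (UMul (UGen x) (UGen y)) (UMul (UConst (-1)) (UMul (UGen y) (UGen x)))).

HB.instance Definition _ := gen_eqMixin uterm.
HB.instance Definition _ := gen_choiceMixin uterm.

Definition ueqb : rel uterm := fun s t => `[< ueq s t >].

Lemma ueqb_equiv : equiv_class_of ueqb.
Proof.
split.
- by move=> t; apply/asboolP; exact: ueq_refl.
- by move=> s t; apply/asboolP/asboolP; exact: ueq_sym.
- by move=> t s r /asboolP st /asboolP tr; apply/asboolP; exact: ueq_trans st tr.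
Qed.

Canonical ueqb_equivRel := EquivRelPack ueqb_equiv.

Definition uea := {eq_quot ueqb_equivRel}.
HB.instance Definition _ := Choice.on uea.
HB.instance Definition _ := EqQuotient.on uea.

Definition gen (x : g) : uea := \pi_uea (UGen x).

Lemma upiP s t : reflect (ueq s t) (\pi_uea s == \pi_uea t).
Proof. by rewrite piE; exact: asboolP. Qed.

Lemma upi s t : ueq s t -> \pi_uea s = \pi_uea t.
Proof. by move=> st; apply/eqP/upiP. Qed.

Lemma ureprP t : ueq (repr (\pi_uea t)) t.
Proof. by apply/upiP; rewrite reprK. Qed.

Definition uconst c : uea := \pi_uea (UConst c).
Definition uadd (s t : uea) : uea :=
  locked (\pi_uea (UAdd (repr s) (repr t))).
Definition umul (s t : uea) : uea :=
  locked (\pi_uea (UMul (repr s) (repr t))).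
Definition uscale c (s : uea) : uea := umul (uconst c) s.
Definition uopp := uscale (-1).

Lemma pi_uadd s t : uadd (\pi_uea s) (\pi_uea t) = \pi_uea (UAdd s t).
Proof. by rewrite /uadd -lock; apply/upi/ueq_add; exact: ureprP. Qed.
Lemma pi_umul s t : umul (\pi_uea s) (\pi_uea t) = \pi_uea (UMul s t).
Proof. by rewrite /umul -lock; apply/upi/ueq_mul; exact: ureprP. Qed.

Let piE := (pi_uadd, pi_umul).

Fact uaddA : associative uadd.
Proof.
elim/quotW=> s; elim/quotW=> t; elim/quotW=> r.
by rewrite !piE; apply: upi; exact: ueq_addA.
Qed.
Fact uaddC : commutative uadd.
Proof. by elim/quotW=> s; elim/quotW=> t; rewrite !piE; apply: upi; exact: ueq_addC. Qed.
Fact uadd0 : left_id (uconst 0) uadd.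
Proof. by elim/quotW=> t; rewrite !piE; apply: upi; exact: ueq_add0. Qed.
Fact uaddN : left_inverse (uconst 0) uopp uadd.
Proof. by elim/quotW=> t; rewrite /uopp /uscale !piE; apply: upi; exact: ueq_addN. Qed.
HB.instance Definition _ := GRing.isZmodule.Build uea uaddA uaddC uadd0 uaddN.

Fact umulA : associative umul.
Proof.
elim/quotW=> s; elim/quotW=> t; elim/quotW=> r.
by rewrite !piE; apply: upi; exact: ueq_mulA.
Qed.
Fact umul1 : left_id (uconst 1) umul.
Proof. by elim/quotW=> t; rewrite !piE; apply: upi; exact: ueq_mul1. Qed.
Fact uconstC c t : umul (uconst c) t = umul t (uconst c).
Proof. by elim/quotW: t => t; rewrite !piE; apply: upi; exact: ueq_constC. Qed.
Fact umulr1 : right_id (uconst 1) umul.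
Proof. by move=> t; rewrite -uconstC umul1. Qed.
Fact umulDl : left_distributive umul +%R.
Proof.
elim/quotW=> s; elim/quotW=> t; elim/quotW=> r.
by rewrite /GRing.add /= !piE; apply: upi; exact: ueq_mulDl.
Qed.
Fact umulDr : right_distributive umul +%R.
Proof.
elim/quotW=> s; elim/quotW=> t; elim/quotW=> r.
by rewrite /GRing.add /= !piE; apply: upi; exact: ueq_mulDr.
Qed.

Section Lift.
Context (B : pzRingType) (s : k -> B) (f : g -> B).

Fixpoint ueval (t : uterm) : B :=
  match t with
  | UGen x => f x
  | UConst c => s c
  | UAdd t r => ueval t + ueval r
  | UMul t r => ueval t * ueval r
  end.

(* The algebra morphism extending [f], where [s] is the structure map of the
   k-algebra B; meaningful under the conditions of [uext_spec]. *)
Definition uext (t : uea) : B := ueval (repr t).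

Record uext_spec : Prop := UextSpec {
  uext_s0 : s 0 = 0;
  uext_s1 : s 1 = 1;
  uext_sD : {morph s : c d / c + d};
  uext_sM : {morph s : c d / c * d};
  uext_sC : forall c b, s c * b = b * s c;
  uext_fD : {morph f : x y / x + y};
  uext_fZ : forall c x, f (c *: x) = s c * f x;
  uext_fL : forall x y, f (lie x y) = f x * f y - f y * f x
}.

Hypothesis H : uext_spec.

Lemma uext_sN1 b : s (-1) * b = - b.
Proof.
apply: (@addIr _ b); rewrite addNr -[X in _ + X]mul1r -(uext_s1 H) -mulrDl.
by rewrite -(uext_sD H) addNr (uext_s0 H) mul0r.
Qed.

Lemma ueval_ueq t r : ueq t r -> ueval t = ueval r.
Proof.
elim=> {t r} //=.
- by move=> t r q _ -> _ ->.
- by move=> t t' r r' _ -> _ ->.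
- by move=> t t' r r' _ -> _ ->.
- by move=> *; rewrite addrA.
- by move=> *; rewrite addrC.
- by move=> *; rewrite (uext_s0 H) add0r.
- by move=> *; rewrite uext_sN1 addNr (uext_s0 H).
- by move=> *; rewrite mulrA.
- by move=> *; rewrite (uext_s1 H) mul1r.
- by move=> *; rewrite mulrDl.
- by move=> *; rewrite mulrDr.
- by move=> *; rewrite (uext_sD H).
- by move=> *; rewrite (uext_sM H).
- by move=> *; rewrite (uext_sC H).
- by move=> *; rewrite (uext_fD H).
- by move=> *; rewrite (uext_fZ H).
- by move=> *; rewrite (uext_fL H) uext_sN1.
Qed.

Lemma uext_pi t : uext (\pi_uea t) = ueval t.
Proof. by apply: ueval_ueq; exact: ureprP. Qed.

Lemma uext_gen x : uext (gen x) = f x.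
Proof. exact: uext_pi. Qed.
Lemma uext_const c : uext (uconst c) = s c.
Proof. exact: uext_pi. Qed.
Lemma uextD t r : uext (t + r) = uext t + uext r.
Proof.
elim/quotW: t => t; elim/quotW: r => r.
have -> : \pi_uea t + \pi_uea r = \pi_uea (UAdd t r) by rewrite -pi_uadd.
by rewrite !uext_pi.
Qed.
Lemma uext_umul t r : uext (umul t r) = uext t * uext r.
Proof.
by elim/quotW: t => t; elim/quotW: r => r; rewrite pi_umul !uext_pi.
Qed.

End Lift.

(* The algebra morphism killing g. *)
Definition counit : uea -> k := uext id (fun _ => 0).

Lemma counit_spec : uext_spec id (fun _ : g => 0 : k).
Proof.
split=> //=.
- by move=> c b; rewrite mulrC.
- by move=> x y; rewrite addr0.
- by move=> c x; rewrite mulr0.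
- by move=> x y; rewrite mulr0 subr0.
Qed.

Fact uone_neq0 : uconst 1 != 0.
Proof.
apply/eqP=> /(congr1 counit).
by rewrite /counit !(uext_const counit_spec); apply/eqP; exact: oner_neq0.
Qed.

HB.instance Definition _ := GRing.Zmodule_isNzRing.Build uea
  umulA umul1 umulr1 umulDl umulDr uone_neq0.

Lemma uconstD c d : uconst (c + d) = uconst c + uconst d.
Proof. by rewrite [RHS]pi_uadd; apply: upi; exact: ueq_constD. Qed.
Lemma uconstM c d : uconst (c * d) = uconst c * uconst d.
Proof. by rewrite [RHS]pi_umul; apply: upi; exact: ueq_constM. Qed.

Fact uscaleA c d t : uscale c (uscale d t) = uscale (c * d) t.
Proof. by rewrite /uscale uconstM umulA. Qed.
Fact uscale1 : left_id 1 uscale.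
Proof. exact: umul1. Qed.
Fact uscaleDr : right_distributive uscale +%R.
Proof. by move=> c s t; rewrite /uscale umulDr. Qed.
Fact uscaleDl t : {morph uscale^~ t : c d / c + d}.
Proof. by move=> c d; rewrite /uscale uconstD umulDl. Qed.
HB.instance Definition _ := GRing.Zmodule_isLmodule.Build k uea
  uscaleA uscale1 uscaleDr uscaleDl.

Fact uscaleAl c (s t : uea) : c *: (s * t) = (c *: s) * t.
Proof. exact: umulA. Qed.
HB.instance Definition _ := GRing.Lmodule_isLalgebra.Build k uea uscaleAl.
Fact uscaleAr c (s t : uea) : c *: (s * t) = s * (c *: t).
Proof. by rewrite -[LHS]/(uconst c * (s * t)) !mulrA [uconst c * s]uconstC -mulrA. Qed.
HB.instance Definition _ := GRing.Lalgebra_isAlgebra.Build k uea uscaleAr.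

Lemma uconstE c : uconst c = c%:A.
Proof. by rewrite -[RHS]/(umul _ _) umulr1. Qed.

Lemma gen_linear : linear gen.
Proof.
move=> c x y.
have -> : gen (c *: x + y) = gen (c *: x) + gen y.
  by rewrite [RHS]pi_uadd; apply: upi; exact: ueq_genD.
congr (_ + _).
by rewrite -[RHS]/(umul _ _) [RHS]pi_umul; apply: upi; exact: ueq_genZ.
Qed.

Lemma gen_lie x y : gen (lie x y) = gen x * gen y - gen y * gen x.
Proof.
rewrite [LHS](upi (ueq_lie x y)) -!pi_uadd -!pi_umul.
by rewrite -[umul (\pi_uea (UConst _)) _]/(- (gen y * gen x)).
Qed.

Lemma uea_ind (P : uea -> Prop) :
  (forall x, P (gen x)) -> (forall c, P c%:A) ->
  (forall s t, P s -> P t -> P (s + t)) ->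
  (forall s t, P s -> P t -> P (s * t)) -> forall t, P t.
Proof.
move=> Pg Pc Pa Pm; elim/quotW; elim=> [x|c|s IHs t IHt|s IHs t IHt].
- exact: Pg.
- by rewrite -/(uconst c) uconstE.
- by rewrite -pi_uadd; exact: Pa.
- by rewrite -pi_umul; exact: Pm.
Qed.

End Enveloping.


Lemma uea_universal (k : fieldType) (g : lieAlgType k) (B : algType k)
    (f : g -> B) :
  linear f -> (forall x y, f (lie x y) = f x * f y - f y * f x) ->
  exists F : {lrmorphism uea g -> B}, (forall x, F (gen x) = f x) /\
    forall F' : {lrmorphism uea g -> B}, (forall x, F' (gen x) = f x) -> F' =1 F.
Proof.
move=> fl fL.
have fD : {morph f : x y / x + y}.
  by move=> x y; have := fl 1 x y; rewrite !scale1r.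
have f0 : f 0 = 0 by apply: (@addIr _ (f 0)); rewrite -fD addr0 add0r.
have sp : uext_spec (fun c => c%:A : B) f.
  split=> //.
  - by rewrite scale0r.
  - by rewrite scale1r.
  - by move=> c d; rewrite scalerDl.
  - by move=> c d; rewrite -scalerAl mul1r scalerA.
  - by move=> c b; rewrite -scalerAl -scalerAr mul1r mulr1.
  - by move=> c x; have := fl c x 0; rewrite f0 !addr0 -scalerAl mul1r.
pose F0 := uext (fun c => c%:A : B) f.
have F0l : linear F0.
  move=> c t r; rewrite /F0 (uextD sp) -[c *: t]/(umul _ _) (uext_umul sp).
  by rewrite (uext_const sp) -scalerAl mul1r.
have F0m : monoid_morphism F0.
  split=> [|t r]; last exact: (uext_umul sp).
  by rewrite -[1]/(uconst g 1) /F0 (uext_const sp) scale1r.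
pose FL := GRing.isLinear.Build k (uea g) B *:%R F0 F0l.
pose FM := GRing.isMonoidMorphism.Build (uea g) B F0 F0m.
pose F : {lrmorphism uea g -> B} := HB.pack F0 FL FM.
exists F; split=> [x|F' F'g]; first exact: (uext_gen sp).
apply: uea_ind => [x|c|s t es et|s t es et].
- by rewrite F'g; apply/esym; exact: (uext_gen sp).
- by rewrite !linearZ !rmorph1.
- by rewrite (linearD F') (linearD F) /= es et.
- by rewrite (rmorphM F') (rmorphM F) /= es et.
Qed.

Fact lie_expand (V : zmodType) (p q u v r s : V) :
  p - q + (r - s) = p + u + (v + r) - (q + v + (u + s)).
Proof.
rewrite [v + r]addrC [u + s]addrC [p + u + _]addrACA [q + v + _]addrACA.
by rewrite [v + u]addrC opprD [RHS]addrACA subrr addr0 opprD addrACA.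
Qed.

Section Hopf.
Context (k : fieldType) (g : lieAlgType k).
Implicit Types (x : g) (t r : uea g).

Lemma gen0 : gen 0 = 0 :> uea g.
Proof. by have := gen_linear (-1) (0 : g) 0; rewrite scaler0 addr0 scaleN1r addNr. Qed.
Lemma genD x y : gen (x + y) = gen x + gen y.
Proof. by have := gen_linear 1 x y; rewrite !scale1r. Qed.
Lemma genZ c x : gen (c *: x) = c *: gen x.
Proof. by have := gen_linear c x 0; rewrite gen0 !addr0. Qed.

Lemma counit_gen x : counit (gen x) = 0.
Proof. exact: (uext_gen (counit_spec g)). Qed.
Lemma counit1 : counit (1 : uea g) = 1.
Proof. exact: (uext_const (counit_spec g)). Qed.
Lemma counitD t r : counit (t + r) = counit t + counit r.
Proof. exact: (uextD (counit_spec g)). Qed.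
Lemma counitM t r : counit (t * r) = counit t * counit r.
Proof. exact: (uext_umul (counit_spec g)). Qed.
Lemma counitZ c t : counit (c *: t) = c * counit t.
Proof.
rewrite -[c *: t]/(umul _ _) /counit (uext_umul (counit_spec g)).
by rewrite (uext_const (counit_spec g)).
Qed.

(* The algebra morphism making the elements of g primitive. *)
Definition comult : uea g -> tens (uea g) (uea g) :=
  @uext k g (tens (uea g) (uea g))
    (fun c => pure c%:A 1) (fun x => pure (gen x) 1 + pure 1 (gen x)).

Lemma comult_spec :
  @uext_spec k g (tens (uea g) (uea g))
    (fun c => pure c%:A 1) (fun x => pure (gen x) 1 + pure 1 (gen x)).
Proof.
have p1M (t : tens (uea g) (uea g)) c : pure c%:A 1 * t = c *: t.
  by rewrite pureZl -tens_scaleAl; congr (_ *: _); exact: mul1r.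
have p1r (t : tens (uea g) (uea g)) c : t * pure c%:A 1 = c *: t.
  by rewrite pureZl -tens_scaleAr; congr (_ *: _); exact: mulr1.
split.
- by rewrite pureZl scale0r.
- by rewrite scale1r.
- by move=> c d; rewrite scalerDl pureDl.
- by move=> c d; rewrite p1M -pureZl scalerA.
- by move=> c b; rewrite p1M p1r.
- by move=> x y; rewrite genD pureDl pureDr addrACA.
- by move=> c x; rewrite genZ pureZl pureZr -scalerDr p1M.
- move=> x y; rewrite gen_lie !mulrDl !mulrDr !mul_pure !mulr1 !mul1r.
  have pN (u v : uea g) : pure (- u) v = - pure u v.
    by rewrite -scaleN1r pureZl scaleN1r.
  have pN' (u v : uea g) : pure u (- v) = - pure u v.
    by rewrite -scaleN1r pureZr scaleN1r.
  by rewrite pureDl pureDr pN pN'; exact: lie_expand.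
Qed.

Lemma comult_gen x : comult (gen x) = pure (gen x) 1 + pure 1 (gen x).
Proof. exact: (uext_gen comult_spec). Qed.
Lemma comult1 : comult 1 = pure 1 1.
Proof. by rewrite /comult (uext_const comult_spec) scale1r. Qed.
Lemma comultD t r : comult (t + r) = comult t + comult r.
Proof. exact: (uextD comult_spec). Qed.
Lemma comultM t r : comult (t * r) = comult t * comult r.
Proof. exact: (uext_umul comult_spec). Qed.
Lemma comultZ c t : comult (c *: t) = c *: comult t.
Proof.
rewrite -[c *: t]/(umul _ _) /comult (uext_umul comult_spec).
rewrite (uext_const comult_spec) pureZl -tens_scaleAl; congr (_ *: _).
exact: mul1r.
Qed.

(* The algebra anti-morphism (morphism to the converse ring) acting by
   -1 on g. *)
Definition antipode : uea g -> uea g :=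
  @uext k g (uea g)^c (fun c => c%:A : uea g) (fun x => - gen x).

Lemma antipode_spec :
  @uext_spec k g (uea g)^c (fun c => c%:A : uea g) (fun x => - gen x).
Proof.
have mA (b : uea g) c : b * c%:A = c *: b by rewrite -scalerAr mulr1.
have Am (b : uea g) c : c%:A * b = c *: b by rewrite -scalerAl mul1r.
have hM c d : (c * d)%:A = d%:A * c%:A :> uea g by rewrite mA scalerA.
have hC c (b : uea g) : b * c%:A = c%:A * b by rewrite mA Am.
have hZ c (x : g) : - gen (c *: x) = - gen x * c%:A.
  by rewrite mA genZ scalerN.
have hL (x y : g) : - gen (lie x y)
    = (- gen y) * (- gen x) - (- gen x) * (- gen y).
  by rewrite !mulrNN gen_lie opprB.
split.
- exact: scale0r.
- exact: scale1r.
- by move=> c d; exact: scalerDl.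
- exact: hM.
- exact: hC.
- by move=> x y; rewrite genD; exact: opprD.
- exact: hZ.
- exact: hL.
Qed.

Lemma antipode_gen x : antipode (gen x) = - gen x.
Proof. exact: (uext_gen antipode_spec). Qed.
Lemma antipode1 : antipode 1 = 1.
Proof. by rewrite /antipode (uext_const antipode_spec) scale1r. Qed.
Lemma antipodeD t r : antipode (t + r) = antipode t + antipode r.
Proof. exact: (uextD antipode_spec). Qed.
Lemma antipodeM t r : antipode (t * r) = antipode r * antipode t.
Proof. exact: (uext_umul antipode_spec). Qed.
Lemma antipodeZ c t : antipode (c *: t) = c *: antipode t.
Proof.
rewrite -[c *: t]/(umul _ _) /antipode (uext_umul antipode_spec).
rewrite (uext_const antipode_spec) -[LHS]/((_ : uea g) * c%:A).
by rewrite -scalerAr mulr1.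
Qed.

End Hopf.

Section Action.
Context (k : fieldType) (g a : lieAlgType k) (M : rightLieModule g a).

Fixpoint deriv_term (b : a) (t : uterm g) : uea g :=
  match t with
  | UGen x => gen (lact M x b)
  | UConst c => 0
  | UAdd t r => deriv_term b t + deriv_term b r
  | UMul t r =>
      deriv_term b t * \pi_(uea g) r + \pi_(uea g) t * deriv_term b r
  end.

(* The derivation of [uea g] extending x |-> x <| b; independent of the
   representative by [deriv_term_ueq]. *)
Definition uderiv (b : a) (X : uea g) : uea g := deriv_term b (repr X).

Fixpoint act_term (A : uterm a) (X : uea g) : uea g :=
  match A with
  | UGen b => uderiv b X
  | UConst c => c *: X
  | UAdd A B => act_term A X + act_term B X
  | UMul A B => act_term B (act_term A X)
  end.

(* The right action X <| A of [uea a] on [uea g], extending [uderiv]: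
   X <| (A B) = (X <| A) <| B (see [uactM]). *)
Definition uact (X : uea g) (A : uea a) : uea g := act_term (repr A) X.

Let piD (t r : uterm g) : \pi_(uea g) (UAdd t r) = \pi_(uea g) t + \pi_(uea g) r.
Proof. by rewrite -pi_uadd. Qed.
Let piM (t r : uterm g) : \pi_(uea g) (UMul t r) = \pi_(uea g) t * \pi_(uea g) r.
Proof. by rewrite -pi_umul. Qed.
Let piC c : \pi_(uea g) (UConst g c) = c%:A.
Proof. by rewrite -uconstE. Qed.
Let piE := (piD, piM, piC).

Let mulA c (X : uea g) : c%:A * X = c *: X.
Proof. by rewrite -scalerAl mul1r. Qed.
Let mulAr c (X : uea g) : X * c%:A = c *: X.
Proof. by rewrite -scalerAr mulr1. Qed.

Let lactDl x y b : lact M (x + y) b = lact M x b + lact M y b.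
Proof. by have := lact_linearl M b 1 x y; rewrite !scale1r. Qed.
Let lact0l b : lact M 0 b = 0.
Proof. by apply: (@addIr _ (lact M 0 b)); rewrite -lactDl addr0 add0r. Qed.
Let lactZl c x b : lact M (c *: x) b = c *: lact M x b.
Proof. by have := lact_linearl M b c x 0; rewrite lact0l !addr0. Qed.
Let lactDr x b c : lact M x (b + c) = lact M x b + lact M x c.
Proof. by have := lact_linearr M x 1 b c; rewrite !scale1r. Qed.
Let lact0r x : lact M x 0 = 0.
Proof. by apply: (@addIr _ (lact M x 0)); rewrite -lactDr addr0 add0r. Qed.
Let lactZr c x b : lact M x (c *: b) = c *: lact M x b.
Proof. by have := lact_linearr M x c b 0; rewrite lact0r !addr0. Qed.

Lemma deriv_term_ueq b t r : ueq t r -> deriv_term b t = deriv_term b r.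
Proof.
elim=> {t r} //=.
- by move=> t r q _ -> _ ->.
- by move=> t t' r r' _ -> _ ->.
- by move=> t t' r r' /upi -> -> /upi -> ->.
- by move=> *; rewrite addrA.
- by move=> *; rewrite addrC.
- by move=> *; rewrite add0r.
- by move=> t; rewrite piC mul0r add0r mulA scaleN1r addNr.
- by move=> t r q; rewrite !piE !mulrDr !mulrDl !mulrA addrA.
- by move=> t; rewrite piC mul0r add0r mulA scale1r.
- by move=> t r q; rewrite !piE !mulrDl addrACA.
- by move=> t r q; rewrite !piE !mulrDr addrACA.
- by move=> *; rewrite addr0.
- by move=> *; rewrite mul0r mulr0 addr0.
- by move=> c t; rewrite !piC mul0r mulr0 addr0 add0r mulA mulAr.
- by move=> x y; rewrite lactDl genD.
- by move=> c x; rewrite piC mul0r add0r mulA lactZl genZ.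
- move=> x y; rewrite !piE mul0r add0r mulA scaleN1r -![\pi_ _ (UGen _)]/(gen _).
  by rewrite lact_lie genD !gen_lie opprD addrACA [X in _ + X]addrC.
Qed.

Lemma uderiv_pi b t : uderiv b (\pi_(uea g) t) = deriv_term b t.
Proof. by apply: deriv_term_ueq; exact: ureprP. Qed.

Lemma uderiv_gen b x : uderiv b (gen x) = gen (lact M x b).
Proof. exact: uderiv_pi. Qed.
Lemma uderivD b X Y : uderiv b (X + Y) = uderiv b X + uderiv b Y.
Proof.
by elim/quotW: X => X; elim/quotW: Y => Y; rewrite -piD !uderiv_pi.
Qed.
Lemma uderivM b X Y : uderiv b (X * Y) = uderiv b X * Y + X * uderiv b Y.
Proof.
by elim/quotW: X => X; elim/quotW: Y => Y; rewrite -piM !uderiv_pi.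
Qed.
Lemma uderivA b c : uderiv b c%:A = 0.
Proof. by rewrite -piC uderiv_pi. Qed.
Lemma uderivZ b c X : uderiv b (c *: X) = c *: uderiv b X.
Proof. by rewrite -mulA uderivM uderivA mul0r add0r mulA. Qed.
Lemma uderiv0 b : uderiv b 0 = 0.
Proof. by have := uderivA b 0; rewrite scale0r. Qed.
Lemma uderivN b X : uderiv b (- X) = - uderiv b X.
Proof. by rewrite -scaleN1r uderivZ scaleN1r. Qed.

Lemma uderiv_addl b c X : uderiv (b + c) X = uderiv b X + uderiv c X.
Proof.
elim/uea_ind: X => [x|d|X Y IX IY|X Y IX IY].
- by rewrite !uderiv_gen lactDr genD.
- by rewrite !uderivA addr0.
- by rewrite !uderivD IX IY addrACA.
- by rewrite !uderivM IX IY mulrDl mulrDr addrACA.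
Qed.

Lemma uderiv_scalel d b X : uderiv (d *: b) X = d *: uderiv b X.
Proof.
elim/uea_ind: X => [x|e|X Y IX IY|X Y IX IY].
- by rewrite !uderiv_gen lactZr genZ.
- by rewrite !uderivA scaler0.
- by rewrite !uderivD IX IY scalerDr.
- by rewrite !uderivM IX IY scalerDr scalerAl scalerAr.
Qed.

Lemma uderiv_lie b c X :
  uderiv (lie b c) X = uderiv c (uderiv b X) - uderiv b (uderiv c X).
Proof.
elim/uea_ind: X => [x|e|X Y IX IY|X Y IX IY].
- by rewrite !uderiv_gen lact_lier -scaleN1r addrC gen_linear scaleN1r addrC.
- by rewrite !uderivA !uderiv0 subr0.
- by rewrite !uderivD IX IY opprD addrACA.
- rewrite !uderivM !uderivD !uderivM IX IY mulrBl mulrBr.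
  exact: lie_expand.
Qed.

Lemma act_term_linear A : linear (act_term A).
Proof.
elim: A => [b|d|A IA B IB|A IA B IB] c X Y /=.
- by rewrite uderivD uderivZ.
- by rewrite scalerDr !scalerA mulrC.
- by rewrite IA IB scalerDr addrACA.
- by rewrite IA IB.
Qed.

Lemma act_term_ueq A B : ueq A B -> act_term A =1 act_term B.
Proof.
have aD A' X Y : act_term A' (X + Y) = act_term A' X + act_term A' Y.
  by have := act_term_linear A' 1 X Y; rewrite !scale1r.
have a0 A' : act_term A' 0 = 0.
  by apply: (@addIr _ (act_term A' 0)); rewrite -aD addr0 add0r.
have aZ A' c X : act_term A' (c *: X) = c *: act_term A' X.
  by have := act_term_linear A' c X 0; rewrite a0 !addr0.
elim=> {A B} //=.
- by move=> A B _ IH X; rewrite IH.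
- by move=> A B C _ IA _ IB X; rewrite IA IB.
- by move=> A A' B B' _ IA _ IB X; rewrite IA IB.
- by move=> A A' B B' _ IA _ IB X; rewrite IA IB.
- by move=> A B C X; rewrite addrA.
- by move=> A B X; rewrite addrC.
- by move=> A X; rewrite scale0r add0r.
- by move=> A X; rewrite aZ scaleN1r addNr scale0r.
- by move=> A X; rewrite scale1r.
- by move=> A B C X; rewrite aD.
- by move=> c d X; rewrite scalerDl.
- by move=> c d X; rewrite scalerA mulrC.
- by move=> c A X; rewrite aZ.
- by move=> b c X; rewrite uderiv_addl.
- by move=> c b X; rewrite uderiv_scalel uderivZ.
- by move=> b c X; rewrite uderiv_lie !uderivZ scaleN1r.
Qed.

Lemma uact_pi X A : uact X (\pi_(uea a) A) = act_term A X.
Proof. by apply: act_term_ueq; exact: ureprP. Qed.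

Lemma uact_gen X b : uact X (gen b) = uderiv b X.
Proof. exact: uact_pi. Qed.
Lemma uactA X c : uact X c%:A = c *: X.
Proof. by rewrite -uconstE; exact: uact_pi. Qed.
Lemma uact1 X : uact X 1 = X.
Proof. by rewrite -(scale1r (1 : uea a)) uactA scale1r. Qed.
Lemma uactM X A B : uact X (A * B) = uact (uact X A) B.
Proof.
elim/quotW: A => A; elim/quotW: B => B.
have -> : \pi_(uea a) A * \pi_(uea a) B = \pi_(uea a) (UMul A B).
  by rewrite -pi_umul.
by rewrite !uact_pi.
Qed.
Lemma uact_linearl A : linear (fun X => uact X A).
Proof. exact: act_term_linear. Qed.
Lemma uact_linearr X : linear (uact X).
Proof.
have aD A B : uact X (A + B) = uact X A + uact X B.
  elim/quotW: A => A; elim/quotW: B => B.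
  have -> : \pi_(uea a) A + \pi_(uea a) B = \pi_(uea a) (UAdd A B).
    by rewrite -pi_uadd.
  by rewrite !uact_pi.
move=> c A B; rewrite aD; congr (_ + _).
have -> : c *: A = c%:A * A by rewrite -scalerAl mul1r.
have := uact_linearl A c X 0; rewrite uactM uactA !addr0 => ->.
have := uact_linearl A 1 0 0; rewrite !scale1r !addr0 => h.
by rewrite (_ : uact 0 A = 0) ?addr0 //; apply: (@addIr _ (uact 0 A)); rewrite -h add0r.
Qed.

End Action.

Section Coalgebra.
Context (k : fieldType) (g h : lieAlgType k).

Definition coalg_mor (T : uea g -> uea h) : Prop :=
  [/\ linear T,
      forall f, counit (T f) = counit f &
      forall f, comult (T f) = tlift (fun u v => pure (T u) (T v)) (comult f)].

End Coalgebra.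

Definition coalg_aut (k : fieldType) (g : lieAlgType k) (e : uea g -> uea g) :=
  coalg_mor e /\
  exists e' : uea g -> uea g, [/\ coalg_mor e', cancel e e' & cancel e' e].

(* The unique element satisfying [P]; [d] if existence or uniqueness fails. *)
Definition the (T : Type) (d : T) (P : T -> Prop) : T :=
  match pselect (exists! x, P x) with
  | left ex => sval (cid ex)
  | right _ => d
  end.

Definition comp_inv (V : nmodType) (f : V -> V) : V -> V :=
  the (fun _ => 0) (fun f' => cancel f f' /\ cancel f' f).

Section Transform.
Context (k : fieldType) (g a : lieAlgType k) (M : rightLieModule g a).

(* (A # B)(f) = A(f_(1) <| S(B(f_(2))_(1))) B(f_(2))_(2) *)
Definition sharp (A B : uea g -> uea a) : uea g -> uea a := fun f =>
  tlift (fun f1 f2 =>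
    tlift (fun b1 b2 =>
      A (uact M f1 (antipode b1)) * b2) (comult (B f2)))
  (comult f).

Definition is_transform (T : uea g -> uea a) (e : uea g -> uea g) : Prop :=
  [/\ linear e,
      forall f, counit (e f) = counit f &
      forall f, e f = tlift (fun f1 f2 => uact M f1 (T (e f2))) (comult f)].

(* The transform e_T. The default value 0 is not invertible, so that a
   transform which is an automorphism exists and is unique. *)
Definition transform (T : uea g -> uea a) : uea g -> uea g :=
  the (fun _ => 0) (is_transform T).

End Transform.

Record is_group (T : Type) (G : T -> Prop) (mul : T -> T -> T) : Prop := IsGroup {
  group_closed : forall x y, G x -> G y -> G (mul x y);
  group_assoc : forall x y z, G x -> G y -> G z ->
    mul x (mul y z) = mul (mul x y) z;
  group_unit_inv : exists e, [/\ G e,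
    forall x, G x -> mul e x = x /\ mul x e = x &
    forall x, G x -> exists y, [/\ G y, mul y x = e & mul x y = e]]
}.

Record group_morphism (T T' : Type) (G : T -> Prop) (mul : T -> T -> T)
    (G' : T' -> Prop) (mul' : T' -> T' -> T') (phi : T -> T') : Prop :=
  GroupMorphism {
    gmor_dom : is_group G mul;
    gmor_cod : is_group G' mul';
    gmor_map : forall x, G x -> G' (phi x);
    gmor_mul : forall x y, G x -> G y -> phi (mul x y) = mul' (phi x) (phi y)
  }.

(* Main.v *)
Require Import Defs.
From mathcomp Require Import all_boot all_algebra.
From mathcomp Require Import boolp classical_sets.
Set Implicit Arguments.
Unset Strict Implicit.
Unset Printing Implicit Defensive.
Import GRing.Theory.
Local Open Scope ring_scope.

(* For a coalgebra morphism A : H -> K put E_A(f) = f_(1) <| S(A(f_(2))), here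
   [twist A].  Since B is a coalgebra morphism, A # B = (A o E_B) * B for the
   convolution product *, and cocommutativity turns this into
   E_(A # B) = E_A o E_B.  The group laws of # follow from those of *, once
   E_A is known to be bijective.  A grouplike element of an enveloping algebra
   is 1, so A 1 = 1 and id - E_A lowers the standard filtration of H: hence E_A
   is bijective.  Its inverse satisfies the equation defining the transform
   e_A, whose solution is unique by the same filtration argument, so
   e_A^-1 = E_A. *)

(** * Linear maps and evaluation on tensors *)

Section Linear.
Context (k : fieldType).
Implicit Types (U V W Z : lmodType k).

Lemma linear_id V : linear (fun x : V => x).
Proof. by []. Qed.

Lemma linear_comp U V W (f : V -> W) (g : U -> V) :
  linear f -> linear g -> linear (fun x => f (g x)).
Proof. by move=> lf lg c x y; rewrite lg lf. Qed.

Lemma linear_add U V (f g : U -> V) :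
  linear f -> linear g -> linear (fun x => f x + g x).
Proof. by move=> lf lg c x y; rewrite lf lg scalerDr addrACA. Qed.

Lemma linear_sub U V (f g : U -> V) :
  linear f -> linear g -> linear (fun x => f x - g x).
Proof. by move=> lf lg c x y; rewrite lf lg opprD addrACA scalerBr. Qed.

Lemma linear_scale U V c (f : U -> V) :
  linear f -> linear (fun x => c *: f x).
Proof. by move=> lf d x y; rewrite lf scalerDr !scalerA mulrC. Qed.

Lemma linear_pure_l U V W (f : U -> V) (w : W) :
  linear f -> linear (fun x => pure (f x) w).
Proof. by move=> lf c x y; rewrite lf pureDl pureZl. Qed.

Lemma linear_pure_r U V W (f : U -> W) (v : V) :
  linear f -> linear (fun x => pure v (f x)).
Proof. by move=> lf c x y; rewrite lf pureDr pureZr. Qed.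

Lemma linear_mul_l U (A : algType k) (f : U -> A) b :
  linear f -> linear (fun x => f x * b).
Proof. by move=> lf c x y; rewrite lf mulrDl scalerAl. Qed.

Lemma linear_mul_r U (A : algType k) (f : U -> A) b :
  linear f -> linear (fun x => b * f x).
Proof. by move=> lf c x y; rewrite lf mulrDr scalerAr. Qed.

Lemma linear_bilin_l U V W Z (F : V -> W -> Z) (f : U -> V) w :
  bilin F -> linear f -> linear (fun x => F (f x) w).
Proof. by move=> [lF _] lf c x y; rewrite lf lF. Qed.

Lemma linear_bilin_r U V W Z (F : V -> W -> Z) (f : U -> W) v :
  bilin F -> linear f -> linear (fun x => F v (f x)).
Proof. by move=> [_ lF] lf c x y; rewrite lf lF. Qed.

Lemma linear0P V W (f : V -> W) : linear f -> f 0 = 0.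
Proof. by move=> lf; have := lf (-1) 0 0; rewrite scaler0 addr0 scaleN1r addNr. Qed.
Lemma linearDP V W (f : V -> W) x y : linear f -> f (x + y) = f x + f y.
Proof. by move=> lf; have := lf 1 x y; rewrite !scale1r. Qed.
Lemma linearZP V W (f : V -> W) c x : linear f -> f (c *: x) = c *: f x.
Proof. by move=> lf; have := lf c x 0; rewrite (linear0P lf) !addr0. Qed.
Lemma linearBP V W (f : V -> W) x y : linear f -> f (x - y) = f x - f y.
Proof. by move=> lf; rewrite linearDP // -scaleN1r linearZP // scaleN1r. Qed.

Lemma eq_tlift V W Z (F G : V -> W -> Z) t :
  (forall v w, F v w = G v w) -> tlift F t = tlift G t.
Proof. by move=> FG; congr (tlift _ t); apply/funext => v; apply/funext. Qed.

(** [tlift] evaluates a chosen representative term, and a linear map commutes with the sums and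
    scalings of that term. *)
Lemma tlift_comp V W Z Z' (L : Z -> Z') (F : V -> W -> Z) t :
  linear L -> L (tlift F t) = tlift (fun v w => L (F v w)) t.
Proof.
move=> lL; rewrite /tlift; elim: (repr t) => //= [s IHs r IHr|c s IHs].
  by rewrite (linearDP _ _ lL) IHs IHr.
by rewrite (linearZP _ _ lL) IHs.
Qed.

Lemma tliftD V W Z (F G : V -> W -> Z) t :
  tlift (fun v w => F v w + G v w) t = tlift F t + tlift G t.
Proof.
rewrite /tlift; elim: (repr t) => //= [s -> r ->|c s ->].
  by rewrite addrACA.
by rewrite scalerDr.
Qed.

Lemma tliftZ V W Z c (F : V -> W -> Z) t :
  tlift (fun v w => c *: F v w) t = c *: tlift F t.
Proof.
rewrite /tlift; elim: (repr t) => //= [s -> r ->|d s ->].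
  by rewrite scalerDr.
by rewrite !scalerA mulrC.
Qed.

Lemma linear_tlift_fun U V W Z (F : U -> V -> W -> Z) t :
  (forall v w, linear (fun x => F x v w)) -> linear (fun x => tlift (F x) t).
Proof.
move=> lF c x y; rewrite -tliftZ -tliftD.
by apply: eq_tlift => v w; exact: lF.
Qed.

(** Interchange of two finite sums: induction on the term representing [s], with [tlift] over [t]
    linear in the function that it evaluates. *)
Lemma tlift_exchange V W V' W' Z (F : V -> W -> V' -> W' -> Z) s t :
  tlift (fun v w => tlift (F v w) t) s =
  tlift (fun v' w' => tlift (fun v w => F v w v' w') s) t.
Proof.
have E (G : V -> W -> Z) : tlift G s = teval G (repr s) by [].
rewrite E; under [RHS]eq_tlift do rewrite E.
elim: (repr s) => [v w|r IHr q IHq|c r IHr] //=.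
  by rewrite IHr IHq -tliftD.
by rewrite IHr -tliftZ.
Qed.

Lemma linear_tlift_arg U V W Z (F : V -> W -> Z) (f : U -> tens V W) :
  bilin F -> linear f -> linear (fun x => tlift F (f x)).
Proof. by move=> bF; apply: linear_comp; exact: tlift_linear. Qed.

End Linear.

Section LinearUea.
Context (k : fieldType) (g a : lieAlgType k) (M : rightLieModule g a).
Implicit Types (U V : lmodType k).

Lemma comult_linear : linear (@comult k g).
Proof. by move=> c x y; rewrite comultD comultZ. Qed.

Lemma antipode_linear : linear (@antipode k g).
Proof. by move=> c x y; rewrite antipodeD antipodeZ. Qed.

Lemma linear_counit U V (f : U -> uea g) (v : V) :
  linear f -> linear (fun x => counit (f x) *: v : V).
Proof. by move=> lf c x y; rewrite lf counitD counitZ scalerDl scalerA. Qed.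

Lemma uact_bilin : bilin (uact M).
Proof. by split=> v; [exact: uact_linearl | exact: uact_linearr]. Qed.

End LinearUea.

(** Discharges the linearity side conditions of Sweedler computations by peeling off the outermost
    operation. A [tlift] may be linear through its function or through its tensor; both are tried,
    last. *)
Ltac lin :=
  lazymatch goal with
  | |- bilin _ => split=> ?; cbv beta; lin
  | _ => first
    [ eassumption
    | exact: linear_id
    | apply: linear_add; lin
    | apply: linear_sub; lin
    | apply: linear_counit; lin
    | apply: linear_scale; lin
    | apply: linear_pure_l; lin
    | apply: linear_pure_r; lin
    | apply: linear_mul_l; lin
    | apply: linear_mul_r; lin
    | apply: (linear_bilin_l _ (uact_bilin _)); lin
    | apply: (linear_bilin_r _ (uact_bilin _)); lin
    | apply: (linear_comp (@antipode_linear _ _)); lin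
    | apply: (linear_comp (@comult_linear _ _)); lin
    | match goal with H : linear _ |- _ => apply: (linear_comp H); lin end
    | match goal with H : bilin _ |- _ => apply: (linear_bilin_l _ H); lin end
    | match goal with H : bilin _ |- _ => apply: (linear_bilin_r _ H); lin end
    | match goal with H : forall _, bilin _ |- _ =>
        apply: (linear_bilin_l _ (H _)); lin end
    | match goal with H : forall _, bilin _ |- _ =>
        apply: (linear_bilin_r _ (H _)); lin end
    | match goal with H : forall _ _, bilin _ |- _ =>
        apply: (linear_bilin_l _ (H _ _)); lin end
    | match goal with H : forall _ _, bilin _ |- _ =>
        apply: (linear_bilin_r _ (H _ _)); lin end
    | match goal with H : forall _ _, linear _ |- _ =>
        apply: (linear_comp (H _ _)); lin end
    | match goal with H : forall _ _ _, linear _ |- _ =>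
        apply: (linear_comp (H _ _ _)); lin end
    | apply: linear_tlift_fun => ? ?; lin
    | apply: linear_tlift_arg; lin ]
  end.

(** * Sweedler calculus *)

Section Sweedler.
Context (k : fieldType).
Implicit Types (Z : lmodType k).

Lemma tlift_mul (A B : algType k) Z (F : A -> B -> Z) s t : bilin F ->
  tlift F (s * t) =
  tlift (fun u v => tlift (fun u' v' => F (u * u') (v * v')) t) s.
Proof.
move=> bF.
rewrite -[s * t]/(tlift _ _) (tlift_comp _ _ (tlift_linear bF)).
apply: eq_tlift => u v; rewrite (tlift_comp _ _ (tlift_linear bF)).
by apply: eq_tlift => u' v'; rewrite tliftE.
Qed.

Context (g : lieAlgType k).
Implicit Types f h : uea g.

Lemma comult_alg c : comult (c%:A : uea g) = c *: pure 1 1.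
Proof. by rewrite comultZ comult1. Qed.

Lemma tlift_comultM Z (F : uea g -> uea g -> Z) f h : bilin F ->
  tlift F (comult (f * h)) = tlift (fun u v =>
    tlift (fun u' v' => F (u * u') (v * v')) (comult h)) (comult f).
Proof. by move=> bF; rewrite comultM tlift_mul. Qed.

Lemma tlift_comult_gen Z (F : uea g -> uea g -> Z) x : bilin F ->
  tlift F (comult (gen x)) = F (gen x) 1 + F 1 (gen x).
Proof.
by move=> bF; rewrite comult_gen (linearDP _ _ (tlift_linear bF)) !tliftE.
Qed.

Lemma tlift_comult1 Z (F : uea g -> uea g -> Z) : bilin F ->
  tlift F (comult 1) = F 1 1.
Proof. by move=> bF; rewrite comult1 tliftE. Qed.

Lemma tlift_comultD Z (F : uea g -> uea g -> Z) f h : bilin F ->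
  tlift F (comult (f + h)) = tlift F (comult f) + tlift F (comult h).
Proof. by move=> bF; rewrite comultD (linearDP _ _ (tlift_linear bF)). Qed.

Lemma tlift_comultZ Z (F : uea g -> uea g -> Z) c f : bilin F ->
  tlift F (comult (c *: f)) = c *: tlift F (comult f).
Proof. by move=> bF; rewrite comultZ (linearZP _ _ (tlift_linear bF)). Qed.

Lemma uea_lind (P : uea g -> Prop) :
  (forall x, P (gen x)) -> P 1 -> (forall c f, P f -> P (c *: f)) ->
  (forall f h, P f -> P h -> P (f + h)) ->
  (forall f h, P f -> P h -> P (f * h)) -> forall f, P f.
Proof. by move=> Pg P1 PZ PD PM; apply: uea_ind => // c; exact: PZ. Qed.

(** Cocommutativity is visible on the primitive generators and passes to products because the
    coproduct is multiplicative. [F] stays general in the induction, so that the hypotheses apply to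
    its translates. *)
Lemma comultC Z (F : uea g -> uea g -> Z) f : bilin F ->
  tlift F (comult f) = tlift (fun u v => F v u) (comult f).
Proof.
elim/uea_lind: f F => [x||c f IH|f h IHf IHh|f h IHf IHh] F.
- by move=> bF; rewrite !tlift_comult_gen //; [rewrite addrC | lin].
- by move=> bF; rewrite !tlift_comult1 //; lin.
- by move=> bF; rewrite !tlift_comultZ //; [rewrite IH | lin].
- by move=> bF; rewrite !tlift_comultD //; [rewrite IHf // IHh | lin].
move=> bF; rewrite tlift_comultM // IHf; last by lin.
rewrite tlift_comultM; last by lin.
by apply: eq_tlift => u v; rewrite IHh; last by lin.
Qed.

End Sweedler.

Section SweedlerLaws.
Context (k : fieldType) (g : lieAlgType k).
Implicit Types (Z : lmodType k) (f h : uea g).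

Lemma tlift_counitr Z (F : uea g -> Z) f : linear F ->
  tlift (fun u v => counit v *: F u) (comult f) = F f.
Proof.
elim/uea_lind: f F => [x||c f IH|f h IHf IHh|f h IHf IHh] F lF.
- rewrite tlift_comult_gen; last by lin.
  by rewrite counit1 counit_gen scale0r scale1r addr0.
- by rewrite tlift_comult1 ?counit1 ?scale1r; last by lin.
- by rewrite tlift_comultZ ?IH ?(linearZP _ _ lF); last by lin.
- by rewrite tlift_comultD ?IHf ?IHh ?(linearDP _ _ lF); last by lin.
rewrite tlift_comultM; last by lin.
transitivity (tlift (fun u v => counit v *: F (u * h)) (comult f)).
  apply: eq_tlift => u v; rewrite -(IHh (fun h => F (u * h))); last by lin.
  by rewrite -tliftZ; apply: eq_tlift => u' v'; rewrite counitM scalerA.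
by rewrite (IHf (fun f => F (f * h))); last by lin.
Qed.

Lemma tlift_counitl Z (F : uea g -> Z) f : linear F ->
  tlift (fun u v => counit u *: F v) (comult f) = F f.
Proof. by move=> lF; rewrite comultC ?tlift_counitr //; lin. Qed.

Lemma coassoc Z (F : uea g -> uea g -> uea g -> Z) f :
  (forall v w, linear (fun u => F u v w)) -> (forall u, bilin (F u)) ->
  tlift (fun u v => tlift (fun u1 u2 => F u1 u2 v) (comult u)) (comult f) =
  tlift (fun u v => tlift (fun v1 v2 => F u v1 v2) (comult v)) (comult f).
Proof.
elim/uea_lind: f F => [x||c f IH|f h IHf IHh|f h IHf IHh] F lF bF.
- rewrite !tlift_comult_gen; try by lin.
  rewrite !tlift_comult1; try by lin.
  by rewrite addrA.
- by rewrite !tlift_comult1 //; lin.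
- by rewrite !tlift_comultZ ?IH //; lin.
- by rewrite !tlift_comultD ?IHf ?IHh //; lin.
rewrite !tlift_comultM; try by lin.
transitivity (tlift (fun u v => tlift (fun u1 u2 =>
   tlift (fun u' v' => tlift (fun u1' u2' => F (u1 * u1') (u2 * u2') (v * v'))
     (comult u')) (comult h)) (comult u)) (comult f)).
  apply: eq_tlift => u v; rewrite tlift_exchange; apply: eq_tlift => u' v'.
  by rewrite tlift_comultM; last by lin.
(* The coproduct of [h] is reassociated with the legs of [f] held fixed; the rewrite with [IHf] then
   treats [f]. *)
transitivity (tlift (fun u v => tlift (fun u1 u2 =>
   tlift (fun u' v' => tlift (fun v1' v2' => F (u1 * u') (u2 * v1') (v * v2'))
     (comult v')) (comult h)) (comult u)) (comult f)).
  apply: eq_tlift => u v; apply: eq_tlift => u1 u2.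
  by rewrite IHh // => *; lin.
rewrite (IHf (fun u1 u2 v => tlift (fun u' v' =>
   tlift (fun v1' v2' => F (u1 * u') (u2 * v1') (v * v2')) (comult v'))
   (comult h))); try by move=> *; lin.
apply: eq_tlift => u v; rewrite tlift_exchange; apply: eq_tlift => u' v'.
by rewrite tlift_comultM; last by lin.
Qed.

(** By coassociativity both sides are sums over f_(1), ..., f_(4), and they differ by exchanging the
    two middle legs, which cocommutativity allows. This is what makes convolution preserve coalgebra
    morphisms. *)
Lemma comult_swap4 Z (F : uea g -> uea g -> uea g -> uea g -> Z) f :
  (forall v w x, linear (fun u => F u v w x)) ->
  (forall u w x, linear (fun v => F u v w x)) -> (forall u v, bilin (F u v)) ->
  tlift (fun u v => tlift (fun u1 u2 =>
    tlift (fun v1 v2 => F u1 u2 v1 v2) (comult v)) (comult u)) (comult f) =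
  tlift (fun u v => tlift (fun u1 u2 =>
    tlift (fun v1 v2 => F u1 v1 u2 v2) (comult v)) (comult u)) (comult f).
Proof.
move=> l1 l2 b3.
rewrite (@coassoc _ (fun u1 u2 v => tlift (F u1 u2) (comult v)));
  [|by move=> *; lin..].
rewrite (@coassoc _ (fun u1 u2 v => tlift (fun v1 v2 => F u1 v1 u2 v2) (comult v))).
- apply: eq_tlift => u v.
  rewrite -(@coassoc _ (F u)); [|by move=> *; lin..].
  rewrite -(@coassoc _ (fun u1 v1 v2 => F u v1 u1 v2)); [|by move=> *; lin..].
  by apply: eq_tlift => v1 v2; rewrite comultC; last by lin.
all: by move=> *; lin.
Qed.

Lemma counit_antipode f : counit (antipode f) = counit f.
Proof.
elim/uea_lind: f => [x||c f IH|f h IHf IHh|f h IHf IHh].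
- by rewrite antipode_gen -scaleN1r counitZ counit_gen mulr0.
- by rewrite antipode1.
- by rewrite antipodeZ !counitZ IH.
- by rewrite antipodeD !counitD IHf IHh.
- by rewrite antipodeM !counitM IHf IHh mulrC.
Qed.

(** The antipode sends primitive generators to primitive elements; its reversal of products is
    absorbed by exchanging the sums over the two factors. *)
Lemma comult_antipode Z (F : uea g -> uea g -> Z) f : bilin F ->
  tlift F (comult (antipode f)) =
  tlift (fun u v => F (antipode u) (antipode v)) (comult f).
Proof.
elim/uea_lind: f F => [x||c f IH|f h IHf IHh|f h IHf IHh] F bF.
- rewrite antipode_gen -scaleN1r tlift_comultZ // !tlift_comult_gen //; last by lin.
  rewrite antipode1 antipode_gen -scaleN1r scalerDr.
  by rewrite !(linearZP _ _ (bF.1 _)) !(linearZP _ _ (bF.2 _)).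
- by rewrite antipode1 !tlift_comult1 ?antipode1 //; lin.
- by rewrite antipodeZ !tlift_comultZ ?IH //; lin.
- by rewrite antipodeD !tlift_comultD ?IHf ?IHh //; lin.
rewrite antipodeM !tlift_comultM //; last by lin.
rewrite IHh; last by lin.
rewrite [RHS]tlift_exchange; apply: eq_tlift => u v.
rewrite IHf; last by lin.
by apply: eq_tlift => u' v'; rewrite !antipodeM.
Qed.

(** For a product the sum is S(h_1) S(f_1) f_2 h_2, whose inner pair collapses to the scalar
    [counit f] before the sum over [h] is taken. *)
Lemma antipode_left f :
  tlift (fun u v => antipode u * v) (comult f) = (counit f)%:A.
Proof.
elim/uea_lind: f => [x||c f IH|f h IHf IHh|f h IHf IHh].
- rewrite tlift_comult_gen; last by lin.
  by rewrite antipode1 antipode_gen counit_gen mul1r mulr1 addNr scale0r.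
- by rewrite tlift_comult1 ?antipode1 ?counit1 ?mul1r ?scale1r; last by lin.
- by rewrite tlift_comultZ ?IH ?counitZ ?scalerA; last by lin.
- by rewrite tlift_comultD ?IHf ?IHh ?counitD ?scalerDl; last by lin.
rewrite tlift_comultM; last by lin.
rewrite tlift_exchange counitM -scalerA -IHh -tliftZ.
apply: eq_tlift => u v; transitivity (antipode u * (counit f)%:A * v).
  rewrite -IHf (tlift_comp _ _ (linear_mul_r _ (@linear_id _ _))).
  rewrite (tlift_comp _ _ (linear_mul_l _ (@linear_id _ _))).
  by apply: eq_tlift => u' v'; rewrite antipodeM !mulrA.
by rewrite -scalerAr mulr1 scalerAl.
Qed.

End SweedlerLaws.

(** * Compatibility of the action with the coalgebra structure *)

Section ActionCoalgebra.
Context (k : fieldType) (g a : lieAlgType k) (M : rightLieModule g a).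
Implicit Types (Z : lmodType k) (X Y : uea g) (A B : uea a).

Lemma uderiv_linear b : linear (uderiv M b).
Proof. by move=> c x y; rewrite uderivD uderivZ. Qed.

(** A derivation sending generators to generators is a coderivation: this holds on primitives, and
    the Leibniz rule carries it to products. *)
Lemma comult_uderiv Z (F : uea g -> uea g -> Z) b X : bilin F ->
  tlift F (comult (uderiv M b X)) =
  tlift (fun u v => F (uderiv M b u) v + F u (uderiv M b v)) (comult X).
Proof.
have lb := uderiv_linear b.
have d1 : uderiv M b 1 = 0 by rewrite -(scale1r (1 : uea g)) uderivA.
elim/uea_lind: X F => [x||c X IH|X Y IX IY|X Y IX IY] F bF.
- rewrite uderiv_gen !tlift_comult_gen //; last by lin.
  rewrite uderiv_gen d1 (linear0P (bF.1 _)) (linear0P (bF.2 _)).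
  by rewrite addr0 add0r.
- rewrite d1 -(scale0r 1) tlift_comultZ // !tlift_comult1 //; last by lin.
  by rewrite d1 (linear0P (bF.1 _)) (linear0P (bF.2 _)) scale0r addr0.
- by rewrite uderivZ !tlift_comultZ ?IH //; lin.
- by rewrite uderivD !tlift_comultD ?IX ?IY //; lin.
rewrite uderivM tlift_comultD // !tlift_comultM //; last by lin.
rewrite IX; last by lin.
rewrite -tliftD; apply: eq_tlift => u v; rewrite IY; last by lin.
rewrite -!tliftD; apply: eq_tlift => u' v'; rewrite !uderivM.
by rewrite !(linearDP _ _ (bF.1 _)) !(linearDP _ _ (bF.2 _)) addrACA.
Qed.

(** Induction on [A] with [X] general: a generator acts by a coderivation, and a product acts by two
    successive actions. *)
Lemma comult_uact Z (F : uea g -> uea g -> Z) X A : bilin F ->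
  tlift F (comult (uact M X A)) = tlift (fun X1 X2 =>
    tlift (fun A1 A2 => F (uact M X1 A1) (uact M X2 A2)) (comult A)) (comult X).
Proof.
have bM := uact_bilin M.
elim/uea_lind: A X F => [b||c A IA|A B IA IB|A B IA IB] X F bF.
- rewrite uact_gen comult_uderiv //; apply: eq_tlift => u v.
  by rewrite tlift_comult_gen ?uact1 ?uact_gen //; lin.
- by rewrite uact1; apply: eq_tlift => u v; rewrite tlift_comult1 ?uact1 //; lin.
- rewrite (linearZP _ _ (bM.2 X)) tlift_comultZ // IA // -tliftZ.
  by apply: eq_tlift => u v; rewrite tlift_comultZ //; lin.
- rewrite (linearDP _ _ (bM.2 X)) tlift_comultD // IA // IB // -tliftD.
  by apply: eq_tlift => u v; rewrite tlift_comultD //; lin.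
rewrite uactM IB // IA; last by lin.
apply: eq_tlift => u v; rewrite tlift_comultM; last by lin.
apply: eq_tlift => u' v'; apply: eq_tlift => u'' v''.
by rewrite !uactM.
Qed.

Lemma counit_uderiv b X : counit (uderiv M b X) = 0.
Proof.
elim/uea_lind: X => [x||c X IH|X Y IX IY|X Y IX IY].
- by rewrite uderiv_gen counit_gen.
- by rewrite -(scale1r (1 : uea g)) uderivA -(scale0r (1 : uea g)) counitZ mul0r.
- by rewrite uderivZ counitZ IH mulr0.
- by rewrite uderivD counitD IX IY addr0.
- by rewrite uderivM counitD !counitM IX IY mul0r mulr0 addr0.
Qed.

Lemma counit_uact X A : counit (uact M X A) = counit X * counit A.
Proof.
have bM := uact_bilin M.
elim/uea_lind: A X => [b||c A IA|A B IA IB|A B IA IB] X.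
- by rewrite uact_gen counit_uderiv counit_gen mulr0.
- by rewrite uact1 counit1 mulr1.
- by rewrite (linearZP _ _ (bM.2 X)) !counitZ IA mulrCA.
- by rewrite (linearDP _ _ (bM.2 X)) !counitD IA IB mulrDr.
- by rewrite uactM IB IA counitM mulrA.
Qed.

Lemma uact_one A : uact M 1 A = (counit A)%:A.
Proof.
have bM := uact_bilin M.
elim/uea_lind: A => [b||c A IA|A B IA IB|A B IA IB].
- by rewrite uact_gen -(scale1r (1 : uea g)) uderivA counit_gen scale0r.
- by rewrite uact1 counit1 scale1r.
- by rewrite (linearZP _ _ (bM.2 1)) counitZ IA scalerA.
- by rewrite (linearDP _ _ (bM.2 1)) counitD IA IB scalerDl.
- by rewrite uactM IA (linearZP _ _ (bM.1 _)) IB scalerA counitM.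
Qed.

End ActionCoalgebra.

(** * Convolution and the product # *)

Section CoalgebraMorphisms.
Context (k : fieldType).
Implicit Types (Z : lmodType k) (g h a : lieAlgType k).

Lemma comult_mor g h (T : uea g -> uea h) Z (F : uea h -> uea h -> Z) f :
  coalg_mor T -> bilin F ->
  tlift F (comult (T f)) = tlift (fun u v => F (T u) (T v)) (comult f).
Proof.
move=> [lT _ cT] bF; rewrite cT (tlift_comp _ _ (tlift_linear bF)).
by apply: eq_tlift => u v; rewrite tliftE.
Qed.

Lemma tlift_pure (V W : lmodType k) (t : tens V W) : tlift (@pure k V W) t = t.
Proof.
have bp : bilin (@pure k V W) by lin.
elim/tens_ind: t => [u v|s t IHs IHt]; first by rewrite tliftE.
by rewrite (linearDP _ _ (tlift_linear bp)) IHs IHt.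
Qed.

Lemma coalg_mor_id g : coalg_mor (@id (uea g)).
Proof. by split=> // f; rewrite tlift_pure. Qed.

Lemma coalg_mor_comp g h a (T : uea h -> uea a) (U : uea g -> uea h) :
  coalg_mor T -> coalg_mor U -> coalg_mor (T \o U).
Proof.
move=> [lT eT cT] mU; have [lU eU _] := mU; split=> [|f|f] /=.
- exact: linear_comp.
- by rewrite eT.
- by rewrite cT comult_mor //; lin.
Qed.

Lemma coalg_mor_antipode g : coalg_mor (@antipode k g).
Proof.
split=> [|f|f]; [exact: antipode_linear | exact: counit_antipode |].
by rewrite -[LHS]tlift_pure comult_antipode; last by lin.
Qed.

(** This trivial morphism is the unit both for convolution and for #. *)
Lemma coalg_mor_counit g h : coalg_mor (fun f : uea g => (counit f)%:A : uea h).
Proof.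
split=> [|f|f]; first by lin.
- by rewrite counitZ counit1 mulr1.
rewrite comult_alg -(tlift_counitr (F := fun u => counit u *: pure 1 1)); last by lin.
by apply: eq_tlift => u v; rewrite pureZl pureZr scalerA mulrC -scalerA.
Qed.

Lemma coalg_mor_inv g h (T : uea g -> uea h) (U : uea h -> uea g) :
  coalg_mor T -> cancel T U -> cancel U T -> coalg_mor U.
Proof.
move=> mT TU UT; have [lT eT cT] := mT.
have lU : linear U by move=> c x y; apply: (can_inj TU); rewrite lT !UT.
split=> // f; first by rewrite -{2}(UT f) eT.
rewrite -{2}(UT f) comult_mor //; last by lin.
by rewrite -[LHS]tlift_pure; apply: eq_tlift => u v; rewrite !TU.
Qed.

(** A coalgebra morphism out of the tensor product of two enveloping algebras, in curried form.
    Multiplication and the action are the two instances. *)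
Definition bicoalg_mor g h a (F : uea g -> uea h -> uea a) : Prop :=
  [/\ bilin F, forall x y, counit (F x y) = counit x * counit y &
      forall x y, comult (F x y) = tlift (fun x1 x2 =>
        tlift (fun y1 y2 => pure (F x1 y1) (F x2 y2)) (comult y)) (comult x)].

Lemma bicoalg_mul g : bicoalg_mor (fun x y : uea g => x * y).
Proof.
split=> [|x y|x y]; [by lin | exact: counitM |].
by rewrite -[LHS]tlift_pure tlift_comultM; last by lin.
Qed.

Lemma bicoalg_uact g a (M : rightLieModule g a) : bicoalg_mor (uact M).
Proof.
split=> [|x y|x y]; [exact: uact_bilin | exact: counit_uact |].
by rewrite -[LHS]tlift_pure comult_uact; last by lin.
Qed.

End CoalgebraMorphisms.

Section Convolution.
Context (k : fieldType) (g : lieAlgType k).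

(** Convolution along an arbitrary pairing: multiplication gives the usual convolution product, and
    the action makes the linear maps from H to H a right module over the convolution algebra of
    linear maps from H to K. *)
Definition conv (V W : Type) (Z : lmodType k) (F : V -> W -> Z)
    (X : uea g -> V) (A : uea g -> W) : uea g -> Z :=
  fun f => tlift (fun u v => F (X u) (A v)) (comult f).

Lemma conv_coalg (h a l : lieAlgType k) (F : uea h -> uea a -> uea l) X A :
  bicoalg_mor F -> coalg_mor X -> coalg_mor A -> coalg_mor (conv F X A).
Proof.
move=> [bF eF cF] mX mA; have [lX eX _] := mX; have [lA eA _] := mA.
split=> [|f|f]; rewrite /conv.
- by lin.
(* The counit is regarded as a linear map to [k^o], the field as a module over itself, so that
   [tlift_comp] applies to it. *)
- have lc : linear (@counit k l : uea l -> k^o).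
    by move=> c x y; rewrite counitD counitZ.
  have lc' : linear (@counit k g : uea g -> k^o).
    by move=> c x y; rewrite counitD counitZ.
  rewrite (tlift_comp _ _ lc) -[RHS](@tlift_counitr k g k^o (@counit k g) f lc').
  apply: (@eq_tlift k _ _ k^o) => u v. by rewrite eF eX eA mulrC.
rewrite (tlift_comp _ _ (@comult_linear _ _)).
transitivity (tlift (fun u v => tlift (fun u1 u2 => tlift (fun v1 v2 =>
    pure (F (X u1) (A v1)) (F (X u2) (A v2))) (comult v)) (comult u)) (comult f)).
  apply: eq_tlift => u v; rewrite cF comult_mor //; last by lin.
  by apply: eq_tlift => u1 u2; rewrite comult_mor //; lin.
rewrite (@comult_swap4 _ _ _
  (fun u1 u2 v1 v2 => pure (F (X u1) (A v1)) (F (X u2) (A v2))));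
  try by move=> *; lin.
apply: eq_tlift => u v.
rewrite (tlift_comp _ _ (linear_pure_l _ (@linear_id _ _))).
apply: eq_tlift => u1 u2.
by rewrite (tlift_comp _ _ (linear_pure_r _ (@linear_id _ _))).
Qed.

End Convolution.

Section ConvolutionLaws.
Context (k : fieldType) (g : lieAlgType k).

Lemma conv_comp (h : lieAlgType k) (V W Z : lmodType k) (F : V -> W -> Z)
    (X : uea g -> V) (A : uea g -> W) (T : uea h -> uea g) :
  bilin F -> linear X -> linear A -> coalg_mor T ->
  conv F X A \o T = conv F (X \o T) (A \o T).
Proof.
by move=> bF lX lA mT; apply/funext => f; rewrite /conv /= (comult_mor _ mT) //; lin.
Qed.

(** Four separate pairings let one statement give both associativity of the convolution product and
    the module law of the action. *)
Lemma conv_assoc (V1 V2 V3 V12 V23 Z : lmodType k) (G : V1 -> V2 -> V12)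
    (F : V12 -> V3 -> Z) (G' : V2 -> V3 -> V23) (F' : V1 -> V23 -> Z)
    (X : uea g -> V1) (A : uea g -> V2) (B : uea g -> V3) :
  bilin G -> bilin F -> bilin G' -> bilin F' ->
  linear X -> linear A -> linear B ->
  (forall x y z, F (G x y) z = F' x (G' y z)) ->
  conv F (conv G X A) B = conv F' X (conv G' A B).
Proof.
move=> bG bF bG' bF' lX lA lB FG; apply/funext => f; rewrite /conv.
under eq_tlift => u v do
  rewrite (tlift_comp _ _ (linear_bilin_l _ bF (@linear_id _ _))).
rewrite (@coassoc _ _ _ (fun u1 u2 v => F (G (X u1) (A u2)) (B v)));
  try by move=> *; lin.
apply: eq_tlift => u v.
rewrite (tlift_comp _ _ (linear_bilin_r _ bF' (@linear_id _ _))).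
by apply: eq_tlift => v1 v2; exact: FG.
Qed.

Lemma conv_unitr (a : lieAlgType k) (V : lmodType k) (F : V -> uea a -> V)
    (X : uea g -> V) :
  bilin F -> linear X -> (forall x, F x 1 = x) ->
  conv F X (fun f => (counit f)%:A) = X.
Proof.
move=> bF lX F1; apply/funext => f; rewrite /conv -[RHS]tlift_counitr //.
by apply: eq_tlift => u v; rewrite (linearZP _ _ (bF.2 _)) F1.
Qed.

Lemma conv_unitl (a : lieAlgType k) (V : lmodType k) (F : uea a -> V -> V)
    (X : uea g -> V) :
  bilin F -> linear X -> (forall x, F 1 x = x) ->
  conv F (fun f => (counit f)%:A) X = X.
Proof.
move=> bF lX F1; apply/funext => f; rewrite /conv -[RHS]tlift_counitl //.
by apply: eq_tlift => u v; rewrite (linearZP _ _ (bF.1 _)) F1.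
Qed.

Context (a : lieAlgType k).
Local Notation mul := (fun x y : uea a => x * y).

Lemma conv_antipodel (A : uea g -> uea a) : coalg_mor A ->
  conv mul (@antipode k a \o A) A = fun f => (counit f)%:A.
Proof.
move=> mA; have [_ eA _] := mA; apply/funext => f; rewrite /conv /=.
by rewrite -eA -antipode_left (comult_mor _ mA) //; lin.
Qed.

(** The antipode reverses the product, and cocommutativity puts the legs of the coproduct back in
    order. *)
Lemma antipode_conv (A B : uea g -> uea a) : linear A -> linear B ->
  @antipode k a \o conv mul A B =
  conv mul (@antipode k a \o B) (@antipode k a \o A).
Proof.
move=> lA lB; apply/funext => f; rewrite /conv /=.
rewrite (tlift_comp _ _ (@antipode_linear _ _)) comultC; last by lin.
by apply: eq_tlift => u v; rewrite antipodeM.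
Qed.

End ConvolutionLaws.

(** * The maps E_A and the laws of # *)

Section Twist.
Context (k : fieldType) (g a : lieAlgType k) (M : rightLieModule g a).
Implicit Types A B C : uea g -> uea a.
Local Notation mul := (fun x y : uea a => x * y).
Local Notation act := (uact M).

Definition twist A : uea g -> uea g := conv act id (@antipode k a \o A).

Lemma coalg_linear h l (T : @uea k h -> @uea k l) : coalg_mor T -> linear T.
Proof. by case. Qed.

Let bm : bilin mul. Proof. by lin. Qed.
Let ba : bilin act. Proof. exact: uact_bilin. Qed.
Let S_mor A : coalg_mor A -> coalg_mor (@antipode k a \o A).
Proof. by move=> mA; apply: coalg_mor_comp => //; exact: coalg_mor_antipode. Qed.
Let act_assoc (X : uea g -> uea g) A B : linear X -> linear A -> linear B ->
  conv act (conv act X A) B = conv act X (conv mul A B).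
Proof. by move=> lX lA lB; apply: conv_assoc => // x y z; rewrite uactM. Qed.

Lemma twist_mor A : coalg_mor A -> coalg_mor (twist A).
Proof.
move=> mA; apply: conv_coalg; [exact: bicoalg_uact | exact: coalg_mor_id |].
exact: S_mor.
Qed.

Lemma twist_unit : twist (fun f => (counit f)%:A) = id.
Proof.
apply/funext => f.
rewrite -[RHS](congr1 (@^~ f) (conv_unitr ba (@linear_id _ _) (uact1 M))).
by apply: eq_tlift => u v /=; rewrite antipodeZ antipode1.
Qed.

(** The legs of B(f_2) are B(f_2) and B(f_3), as [B] is a coalgebra morphism; coassociativity then
    groups f_1 with f_2 into E_B. *)
Lemma sharpE A B : coalg_mor A -> coalg_mor B ->
  sharp M A B = conv mul (A \o twist B) B.
Proof.
move=> mA mB; have [lA _ _] := mA; have [lB _ _] := mB.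
apply/funext => f; rewrite /sharp /conv /=.
transitivity (tlift (fun u v => tlift (fun v1 v2 =>
    A (uact M u (antipode (B v1))) * B v2) (comult v)) (comult f)).
  by apply: eq_tlift => u v; rewrite (comult_mor _ mB) //; lin.
rewrite -(@coassoc _ _ _ (fun u v w => A (uact M u (antipode (B v))) * B w));
  try by move=> *; lin.
apply: eq_tlift => u v; rewrite /twist /conv (tlift_comp _ _ lA).
by rewrite (tlift_comp _ _ (linear_mul_l _ (@linear_id _ _))).
Qed.

Lemma sharp_mor A B : coalg_mor A -> coalg_mor B -> coalg_mor (sharp M A B).
Proof.
move=> mA mB; rewrite sharpE //; apply: conv_coalg => //.
  exact: bicoalg_mul.
by apply: coalg_mor_comp => //; exact: twist_mor.
Qed.

Lemma twist_comp A (X : uea g -> uea g) : coalg_mor A -> coalg_mor X ->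
  twist A \o X = conv act X (@antipode k a \o A \o X).
Proof.
move=> mA mX; rewrite /twist conv_comp //.
exact: coalg_linear (S_mor mA).
Qed.

(** Writing X <| A for convolution along the action, id <| S((A o E_B) * B) = (id <| (S o B)) <| (S
    o A o E_B) = E_B <| (S o A o E_B), which is E_A o E_B. *)
Lemma twist_sharp A B : coalg_mor A -> coalg_mor B ->
  twist (sharp M A B) = twist A \o twist B.
Proof.
move=> mA mB; have mAB := coalg_mor_comp mA (twist_mor mB).
rewrite twist_comp ?sharpE //; last exact: twist_mor.
rewrite {1}/twist antipode_conv; try exact: coalg_linear.
rewrite -act_assoc //; first exact: coalg_linear (S_mor mB).
exact: coalg_linear (S_mor mAB).
Qed.

(** Both sides equal the convolution of A o E_B o E_C, B o E_C and C. *)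
Lemma sharpA A B C : coalg_mor A -> coalg_mor B -> coalg_mor C ->
  sharp M A (sharp M B C) = sharp M (sharp M A B) C.
Proof.
move=> mA mB mC; have mt := twist_mor.
rewrite [LHS]sharpE ?[RHS]sharpE //; try exact: sharp_mor.
rewrite twist_sharp // (sharpE mA mB) (sharpE mB mC).
have mABt : coalg_mor (A \o twist B) by apply: coalg_mor_comp; [|exact: mt].
have mBt : coalg_mor (B \o twist C) by apply: coalg_mor_comp; [|exact: mt].
rewrite (conv_comp bm _ _ (mt _ mC)); try exact: coalg_linear.
rewrite (conv_assoc (F' := mul) (G' := mul)) //; try exact: coalg_linear.
  by apply: coalg_linear; apply: coalg_mor_comp; [|exact: mt].
by move=> x y z; rewrite mulrA.
Qed.

Lemma sharp_unitl A : coalg_mor A -> sharp M (fun f => (counit f)%:A) A = A.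
Proof.
move=> mA; rewrite sharpE //; last exact: coalg_mor_counit.
have [_ et _] := twist_mor mA.
rewrite (_ : _ \o _ = (fun f => (counit f)%:A)); last first.
  by apply/funext => f /=; rewrite et.
by apply: conv_unitl => //; [exact: coalg_linear | exact: mul1r].
Qed.

Lemma sharp_unitr A : coalg_mor A -> sharp M A (fun f => (counit f)%:A) = A.
Proof.
move=> mA; rewrite sharpE //; last exact: coalg_mor_counit.
by rewrite twist_unit; apply: conv_unitr => //; [exact: coalg_linear | exact: mulr1].
Qed.

(** Precomposing S o A o e with E_A leaves S o A, the convolution inverse of [A]. *)
Lemma sharp_left_inverse A e : coalg_mor A -> coalg_mor e ->
  cancel (twist A) e ->
  sharp M (@antipode k a \o A \o e) A = fun f => (counit f)%:A.
Proof.
move=> mA me eK; rewrite sharpE //; last first.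
  by apply: coalg_mor_comp => //; exact: S_mor.
rewrite -(conv_antipodel mA); apply/funext => f.
by apply: eq_tlift => u v /=; rewrite eK.
Qed.

(** Let A o e act by convolution on E_A o e = id. On one side this gives id <| (A o e); on the
    other, e <| ((S o A o e) * (A o e)) = e. The resulting equality is the equation of the
    transform. *)
Lemma twist_inv_transform A e : coalg_mor A -> coalg_mor e ->
  cancel e (twist A) -> is_transform M A e.
Proof.
move=> mA me eK; have [le ee _] := me; split=> // f.
have mAe := coalg_mor_comp mA me.
have defe : e = conv act id (A \o e).
  have tid : twist A \o e = id by apply/funext.
  transitivity (conv act (twist A \o e) (A \o e)); last by rewrite tid.
  rewrite twist_comp // act_assoc //; last exact: coalg_linear.
    by rewrite (conv_antipodel mAe) conv_unitr //; exact: uact1.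
  exact: coalg_linear (S_mor mAe).
by rewrite {1}defe.
Qed.

End Twist.

(** * The standard filtration *)

Section Functional.
Context (k : fieldType) (V : lmodType k).
Local Open Scope classical_set_scope.

Definition subspace (W : set V) : Prop :=
  W 0 /\ forall c x y, W x -> W y -> W (c *: x + y).

Lemma subspaceB W x y : subspace W -> W x -> W y -> W (x - y).
Proof. by move=> [_ Wl] Wx Wy; rewrite addrC -scaleN1r; exact: Wl. Qed.

Lemma subspaceZ W c x : subspace W -> W x -> W (c *: x).
Proof. by move=> [W0 Wl] Wx; rewrite -[_ *: _]addr0; exact: Wl. Qed.

Lemma subspaceD W x y : subspace W -> W x -> W y -> W (x + y).
Proof. by move=> [_ Wl] Wx Wy; rewrite -[x]scale1r; exact: Wl. Qed.

Lemma hyperplane_avoiding W v : subspace W -> ~ W v ->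
  exists U, [/\ subspace U, W `<=` U, ~ U v & forall x, exists c, U (x - c *: v)].
Proof.
move=> sW Wv.
(* Taking the union with [W] makes the empty set admissible, as the empty chain requires. *)
pose P A := subspace (W `|` A) /\ ~ (W `|` A) v.
have [|A [[sU Uv] maxA]] := @Zorn_bigcup V P.
  move=> F FP totF; split; last first.
    case=> // -[X FX Xv]; case: (FP _ FX) => _; apply; by right.
  split; first by left; exact: sW.1.
  have step c x y X : F X -> (W `|` X) x -> (W `|` X) y ->
      (W `|` \bigcup_(X in F) X) (c *: x + y).
    move=> FX Xx Xy; case: ((FP _ FX).1.2 c x y Xx Xy) => ?; first by left.
    by right; exists X.
  move=> c x y [Wx|[X FX Xx]] [Wy|[Y FY Yy]].
  - by left; exact: sW.2.
  - by apply: (step _ _ _ Y) => //; [left|right].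
  - by apply: (step _ _ _ X) => //; [right|left].
  - have [XY|YX] := totF _ _ FX FY.
      by apply: (step _ _ _ Y) => //; right => //; exact: XY.
    by apply: (step _ _ _ X) => //; right => //; exact: YX.
set U := W `|` A in sU Uv.
exists U; split=> // [x Wx|x]; first by left.
apply: contrapT => nx.
(* If no multiple of [v] corrects [x] into [U], then U + k x still avoids [v], against
   maximality. *)
pose U' := [set y | exists2 u, U u & exists c, y = u + c *: x].
have UU' : U `<=` U' by move=> u Uu; exists u => //; exists 0; rewrite scale0r addr0.
have WU' : W `|` U' = U'.
  by apply/seteqP; split=> [y [Wy|//]|y]; [apply: UU'; left | right].
apply: (maxA U'); first split.
- by move=> y Ay; apply: UU'; right.
- move=> U'A; apply: nx; exists 0; rewrite scale0r subr0; right; apply: U'A.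
  by exists 0; [exact: sU.1 | exists 1; rewrite scale1r add0r].
rewrite /P WU'; split.
  split; first by apply: UU'; exact: sU.1.
  move=> c _ _ [y Uy [d ->]] [z Uz [e ->]]; exists (c *: y + z).
    exact: sU.2.
  by exists (c * d + e); rewrite scalerDr scalerDl scalerA addrACA.
move=> [u Uu [c vE]]; have [c0|c0] := eqVneq c 0.
  by apply: Uv; rewrite vE c0 scale0r addr0.
apply: nx; exists c^-1.
rewrite vE scalerDr scalerA mulVf // scale1r opprD addrCA subrr addr0 -scaleNr.
exact: subspaceZ.
Qed.

(** [phi x] is the coefficient c for which x - c v lies in the hyperplane; it is unique because [v]
    lies outside. *)
Lemma functional_avoiding W v : subspace W -> ~ W v ->
  exists phi : V -> k,
    [/\ forall c x y, phi (c *: x + y) = c * phi x + phi y,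
        forall x, W x -> phi x = 0 & phi v = 1].
Proof.
move=> sW Wv; have [U [sU WU Uv Ux]] := hyperplane_avoiding sW Wv.
have uniq x c d : U (x - c *: v) -> U (x - d *: v) -> c = d.
  move=> Uc Ud; apply/eqP; rewrite -subr_eq0; apply/eqP/eqP; apply: contrapT.
  move=> /negP cd; apply: Uv; have := subspaceB sU Ud Uc.
  rewrite opprB addrC addrA subrK -scalerBl => /(subspaceZ (c - d)^-1 sU).
  by rewrite scalerA mulVf // scale1r.
pose phi x := sval (cid (Ux x)).
have phiP x : U (x - phi x *: v) by rewrite /phi; case: cid.
exists phi; split=> [c x y|x Wx|].
- apply: (uniq (c *: x + y)) => //.
  rewrite scalerDl opprD addrACA -scalerA -scalerBr.
  exact: sU.2.
- by apply: (uniq x) => //; rewrite scale0r subr0; exact: WU.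
- by apply: (uniq v) => //; rewrite scale1r subrr; exact: sU.1.
Qed.

End Functional.

Section Filtration.
Context (k : fieldType) (g : lieAlgType k).
Implicit Types f h : uea g.

(* [filt n.+1] is the span of the products of at most n elements of g, and
   [filt 0] is the zero space. *)
Inductive filt : nat -> uea g -> Prop :=
  | filt0 n : filt n 0
  | filt1 n : filt n.+1 1
  | filtl n c f h : filt n f -> filt n h -> filt n (c *: f + h)
  | filt_gen n x f : filt n f -> filt n.+1 (gen x * f).

Lemma filt_subspace n : subspace (filt n).
Proof. by split=> [|c f h]; [exact: filt0 | exact: filtl]. Qed.

Lemma filtS n f : filt n f -> filt n.+1 f.
Proof.
elim=> {n f} *; [exact: filt0 | exact: filt1 | exact: filtl | exact: filt_gen].
Qed.

Lemma filt_le m n f : (m <= n)%N -> filt m f -> filt n f.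
Proof.
by move=> /subnK <-; elim: (n - m)%N => // d IH fm; apply: filtS; exact: IH.
Qed.

Lemma filtM m n f h : filt m f -> filt n h -> filt (m + n) (f * h).
Proof.
move=> mf nh; elim: mf => {m f} [m|m|m c f f' _ IH _ IH'|m x f _ IH].
- by rewrite mul0r; exact: filt0.
- by rewrite mul1r; apply: filt_le nh; rewrite leq_addl.
- by rewrite mulrDl -scalerAl; exact: filtl.
- by rewrite -mulrA; exact: filt_gen.
Qed.

Lemma filt_exhaust f : exists n, filt n f.
Proof.
elim/uea_lind: f => [x||c f [m mf]|f h [m mf] [n nh]|f h [m mf] [n nh]].
- by exists 2; rewrite -[gen x]mulr1; apply: filt_gen; exact: filt1.
- by exists 1%N; exact: filt1.
- by exists m; apply: subspaceZ => //; exact: filt_subspace.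
- exists (m + n)%N; apply: subspaceD; first exact: filt_subspace.
    by apply: filt_le mf; rewrite leq_addr.
  by apply: filt_le nh; rewrite leq_addl.
- by exists (m + n)%N; exact: filtM.
Qed.

Lemma filt_0 f : filt 0 f -> f = 0.
Proof.
move En : 0%N => n nf; elim: nf En => // m c f1 f2 _ IH1 _ IH2 m0.
by rewrite IH1 // IH2 // scaler0 addr0.
Qed.

(* Says that Delta f lies in (filt n) (x) 1 + (filt n.-1) (x) H, in a form tested
   by bilinear maps, which avoids subspaces of the tensor product. *)
Lemma comult_filt n f (Z : lmodType k) (W : Z -> Prop)
    (F : uea g -> uea g -> Z) :
  bilin F -> subspace W -> filt n f ->
  (forall u, filt n u -> W (F u 1)) ->
  (forall u v, filt n.-1 u -> W (F u v)) ->
  W (tlift F (comult f)).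
Proof.
move=> bF sW nf.
elim: nf F bF => {n f} [n|n|n c f h _ IHf _ IHh|n x f nf IH] F bF W1 WF.
- by rewrite -(scale0r 1) tlift_comultZ // scale0r; exact: sW.1.
- by rewrite tlift_comult1 //; apply: W1; exact: filt1.
- by rewrite tlift_comultD // tlift_comultZ //; apply: sW.2; [exact: IHf | exact: IHh].
(* The term x (x) 1 of Delta x lengthens the first leg, while 1 (x) x leaves it in [filt n], one
   step below [n.+1]. *)
rewrite tlift_comultM // tlift_comult_gen; last by lin.
rewrite -tliftD; apply: IH; first by lin.
  move=> u nu; rewrite mulr1 !mul1r; apply: subspaceD => //.
    by apply: W1; exact: filt_gen.
  exact: WF.
move=> u v nu; rewrite !mul1r; apply: subspaceD => //; apply: WF => /=.
  (* For n = 0 the truncated predecessor is again 0, so u = 0. *)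
  by case: n nu {nf W1} => [/filt_0->|n]; [rewrite mulr0; exact: filt0 | exact: filt_gen].
by apply: filt_le nu; exact: leq_pred.
Qed.

(* Choose n minimal with u in [filt n.+1] and a functional phi vanishing on
   [filt n] with phi u = 1; applied to Delta u = u (x) u, the bilinear map
   phi(x) (y - counit y) gives u = 1. *)
Lemma grouplike_eq1 (u : uea g) :
  counit u = 1 -> comult u = pure u u -> u = 1.
Proof.
move=> eu cu; have exn : exists n, `[< filt n u >].
  by have [n nu] := filt_exhaust u; exists n; apply/asboolP.
case: (ex_minnP exn) => -[|n] /asboolP nu nmin.
  move: eu; rewrite (filt_0 nu) -(scale0r (1 : uea g)) counitZ mul0r.
  by move=> /esym/eqP; rewrite oner_eq0.
have nu' : ~ filt n u by move=> /asboolP /nmin; rewrite ltnn.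
have [phi [lphi phi0 phi1]] := functional_avoiding (filt_subspace n) nu'.
pose F (x y : uea g) := phi x *: (y - (counit y)%:A).
have bF : bilin F.
  split=> [w c x y|v]; first by rewrite /F lphi scalerDl scalerA.
  by rewrite /F; lin.
have := @comult_filt n.+1 u _ (fun z => z = 0) F bF.
rewrite cu tliftE // /F phi1 scale1r eu scale1r => h.
apply/eqP; rewrite -subr_eq0; apply/eqP; apply: h => //.
- by split=> // c x y -> ->; rewrite scaler0 addr0.
- by move=> x _; rewrite counit1 scale1r subrr scaler0.
- by move=> x y /phi0 ->; rewrite scale0r.
Qed.

End Filtration.

(** * The transform *)

Section Transform.
Context (k : fieldType) (g a : lieAlgType k) (M : rightLieModule g a).
Implicit Types A B : uea g -> uea a.

Lemma coalg_mor1 A : coalg_mor A -> A 1 = 1.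
Proof.
move=> mA; have [lA eA cA] := mA; apply: grouplike_eq1.
  by rewrite eA counit1.
by rewrite cA tlift_comult1; last by lin.
Qed.

(** A derivation replaces one generator of a product by another, which keeps the length. *)
Lemma filt_uderiv n b f : filt n f -> filt n (uderiv M b f).
Proof.
elim=> {n f} [n|n|n c f h _ IHf _ IHh|n x f nf IH].
- by rewrite uderiv0; exact: filt0.
- by rewrite -(scale1r (1 : uea g)) uderivA; exact: filt0.
- by rewrite uderivD uderivZ; exact: filtl.
- rewrite uderivM uderiv_gen; apply: subspaceD; first exact: filt_subspace.
    exact: filt_gen.
  exact: filt_gen.
Qed.

Lemma filt_uact n f X : filt n f -> filt n (uact M f X).
Proof.
have lr := (uact_bilin M).2.
elim/uea_lind: X f => [b||c X IX|X Y IX IY|X Y IX IY] f nf.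
- by rewrite uact_gen; exact: filt_uderiv.
- by rewrite uact1.
- by rewrite (linearZP _ _ (lr f)); apply: subspaceZ; [exact: filt_subspace | exact: IX].
- rewrite (linearDP _ _ (lr f)).
  by apply: subspaceD; [exact: filt_subspace | exact: IX | exact: IY].
- by rewrite uactM; apply: IY; exact: IX.
Qed.

(** The difference is f_1 <| (counit f_2 - S(A f_2)). A first leg of full length is paired with 1,
    where this bracket vanishes since A 1 = 1; every other first leg is shorter, and the action
    preserves the filtration. *)
Lemma twist_filt A n f : coalg_mor A -> filt n.+1 f -> filt n (f - twist M A f).
Proof.
move=> mA nf; have [lA eA _] := mA.
pose F (u v : uea g) := uact M u ((counit v)%:A - antipode (A v)).
have bF : bilin F by rewrite /F; lin.
have -> : f - twist M A f = tlift F (comult f).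
  have fE : f = tlift (fun u v => uact M u (counit v)%:A) (comult f).
    have actu := conv_unitr (uact_bilin M) (@linear_id _ _) (uact1 M).
    exact/esym/(congr1 (@^~ f) actu).
  rewrite {1}fE /twist /conv -[- tlift _ _]scaleN1r -tliftZ -tliftD.
  apply: eq_tlift => u v; rewrite /F scaleN1r.
  by rewrite (linearBP _ _ ((uact_bilin M).2 u)).
apply: (comult_filt bF (filt_subspace g n) nf) => [u _|u v nu].
  rewrite /F counit1 scale1r coalg_mor1 // antipode1 subrr.
  by rewrite (linear0P ((uact_bilin M).2 u)); exact: filt0.
exact: filt_uact.
Qed.

(** E_A is unipotent along the filtration: f = E_A f + (f - E_A f) with a remainder one step lower,
    so injectivity and surjectivity follow by induction on the step. *)
Lemma twist_bij A : coalg_mor A ->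
  exists e, [/\ coalg_mor e, cancel (twist M A) e & cancel e (twist M A)].
Proof.
move=> mA; have mt := twist_mor M mA; have lt := coalg_linear mt.
have inj f : twist M A f = 0 -> f = 0.
  move=> t0; have [n nf] := filt_exhaust f.
  elim: n nf => [/filt_0//|n IH /(twist_filt mA)].
  by rewrite t0 subr0.
have surj f : exists h, twist M A h = f.
  have [n] := filt_exhaust f; elim: n f => [f /filt_0 ->|n IH f nf].
    by exists 0; exact: linear0P.
  have [h hE] := IH _ (twist_filt mA nf); exists (f + h).
  by rewrite (linearDP _ _ lt) hE addrCA subrr addr0.
pose e f := sval (cid (surj f)).
have eK : cancel e (twist M A) by move=> f; rewrite /e; case: cid.
have Ke : cancel (twist M A) e.
  move=> f; apply/eqP; rewrite -subr_eq0; apply/eqP; apply: inj.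
  by rewrite (linearBP _ _ lt) eK subrr.
by exists e; split=> //; exact: coalg_mor_inv mt Ke eK.
Qed.

(** The difference d of two solutions satisfies d f = f_2 <| A(d f_1) by cocommutativity. Where f_2
    = 1 the term is the counit of A(d f_1), zero since both solutions preserve the counit; elsewhere
    f_1 is lower in the filtration and d f_1 = 0 by induction. *)
Lemma is_transform_unique A e e' : coalg_mor A ->
  is_transform M A e -> is_transform M A e' -> e = e'.
Proof.
move=> mA [le ee Ee] [le' ee' Ee']; have [lA eA _] := mA.
apply/funext => f; apply/eqP; rewrite -subr_eq0; apply/eqP.
pose d f := e f - e' f; rewrite -/(d f).
have ld : linear d by rewrite /d; lin.
pose F (u v : uea g) := uact M v (A (d u)).
have bF : bilin F by rewrite /F; lin.
have Ed h : d h = tlift F (comult h).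
  rewrite comultC // [LHS]/d Ee Ee' -[- tlift _ _]scaleN1r -tliftZ -tliftD.
  apply: eq_tlift => u v; rewrite /F scaleN1r.
  by rewrite (linearBP _ _ lA) (linearBP _ _ ((uact_bilin M).2 u)).
have sW : subspace (fun z : uea g => z = 0).
  by split=> // c x y -> ->; rewrite scaler0 addr0.
have [n nf] := filt_exhaust f; elim: n f nf => [f /filt_0 ->|n IH f nf].
  exact: linear0P.
rewrite Ed; apply: (comult_filt bF sW nf) => [u _|u v nu].
  rewrite /F uact_one eA /d counitD -scaleN1r counitZ ee ee'.
  by rewrite mulN1r subrr scale0r.
by rewrite /F IH // (linear0P lA) (linear0P ((uact_bilin M).2 v)).
Qed.

End Transform.

(** * The group morphism *)

Lemma theE T (d x : T) (P : T -> Prop) :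
  P x -> (forall y, P y -> x = y) -> the d P = x.
Proof.
move=> Px Pu; rewrite /the; case: pselect => [ex|[]]; last by exists x.
by case: (cid ex) => y [Py yu] /=; apply/esym/Pu.
Qed.

Lemma comp_inv_transform (k : fieldType) (g a : lieAlgType k)
    (M : rightLieModule g a) A :
  coalg_mor A -> comp_inv (transform M A) = twist M A.
Proof.
move=> mA; have [e [me Ke eK]] := twist_bij M mA.
have te := twist_inv_transform mA me eK.
have -> : transform M A = e.
  by apply: theE => // e' te'; exact: is_transform_unique te te'.
apply: theE => // f [_ fK]; apply/funext => x.
by rewrite -[x in LHS]fK eK.
Qed.

(** If y x = e and z y = e, then x y = (z y)(x y) = z ((y x) y) = z y = e. *)
Lemma is_group_left_inverse T (G : T -> Prop) mul e :
  (forall x y, G x -> G y -> G (mul x y)) ->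
  (forall x y z, G x -> G y -> G z -> mul x (mul y z) = mul (mul x y) z) ->
  G e -> (forall x, G x -> mul e x = x) -> (forall x, G x -> mul x e = x) ->
  (forall x, G x -> exists2 y, G y & mul y x = e) -> is_group G mul.
Proof.
move=> Gm mA Ge m1 mr1 inv; split=> //; exists e; split=> // [x Gx|x Gx].
  by rewrite m1 ?mr1.
have [y Gy yx] := inv x Gx; have [z Gz zy] := inv y Gy.
exists y; split=> //; rewrite -[LHS]m1; last exact: Gm.
by rewrite -{1}zy -mA //; [rewrite (mA y) // yx m1 | exact: Gm].
Qed.

Theorem theorem4p3p3 (k : fieldType) (char0 : [pchar k] =i pred0)
    (g a : lieAlgType k) (M : rightLieModule g a) :
  group_morphism
    (@coalg_mor k g a) (@sharp k g a M)
    (@coalg_aut k g) (fun e e' : uea g -> uea g => e \o e')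
    (fun A : uea g -> uea a => comp_inv (transform M A)).
Proof.
split.
- apply: (is_group_left_inverse (e := fun f => (counit f)%:A)).
  + by move=> A B; exact: sharp_mor.
  + by move=> A B C; exact: sharpA.
  + exact: coalg_mor_counit.
  + by move=> A; exact: sharp_unitl.
  + by move=> A; exact: sharp_unitr.
  move=> A mA; have [e [me Ke _]] := twist_bij M mA.
  (* The inverse of [A] for # is S o A o E_A^-1. *)
  exists (@antipode k a \o A \o e); last exact: sharp_left_inverse.
  do 2 apply: coalg_mor_comp => //; exact: coalg_mor_antipode.
- apply: (is_group_left_inverse (e := id)) => //.
  + move=> x y [mx [x' [mx' xK Kx]]] [my [y' [my' yK Ky]]].
    split; first exact: coalg_mor_comp.
    exists (y' \o x'); split; first exact: coalg_mor_comp.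
      exact: can_comp.
    exact: can_comp.
  + by split; [|exists id; split=> //]; exact: coalg_mor_id.
  + move=> x [mx [x' [mx' xK Kx]]]; exists x'; first by split=> //; exists x.
    exact/funext.
- move=> A mA; rewrite comp_inv_transform //; split; first exact: twist_mor.
  exact: twist_bij.
(* Since e_A^-1 = E_A, the identity to prove is E_(A # B) = E_A o E_B. *)
- move=> A B mA mB; rewrite !comp_inv_transform //; last exact: sharp_mor.
  exact: twist_sharp.
Qed.
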